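(* Let $\mathcal{T},\mathcal{Y}\in\mathbb{R}^{R\times R\times 2}$. Assume that $\mathcal{T}$ is slice mix invertible and has real rank $R$ with CPD $\mathcal{T}=[\![\mathbf{A},\mathbf{B},\mathbf{C}]\!]$ (real factor matrices), where the columns of $\mathbf{C}$ are normalized to have unit norm. Let $\mathrm{span}(\lambda_1),\dots,\mathrm{span}(\lambda_R)$, with $\lambda_r\in\mathbb{R}^2\setminus\{0\}$, be the generalized eigenvalues of $\mathcal{T}$ (listed with multiplicity), indexed so that $$0\le \theta(\lambda_r)\le\theta(\lambda_{r+1})<\pi\qquad\text{for } r=1,\dots,R-1,$$ and assume that at least $J$ of the generalized eigenvalues $\mathrm{span}(\lambda_r)$ are distinct. Define $\lambda_{R+1}=\lambda_1$ and let $\delta$ be the $J$th largest element (counted with multiplicity) of the family $$\left\{\frac{\chi(\lambda_r,\lambda_{r+1})}{2}\right\}_{r=1}^R .$$ Set $\epsilon_1=\sigma_{\min}(\mathbf{A})\,\sigma_{\min}(\mathbf{B})\,\delta$ and let $\epsilon_2$ be the distance in the spectral norm from $\mathcal{T}$ to the nearest pencil which is not slice mix invertible. If $$\|\mathcal{T}-\mathcal{Y}\|_{\mathrm{sp}}<\min\{\epsilon_1,\epsilon_2\},$$ then $\mathcal{Y}$ has at least $J$ distinct (possibly complex valued) generalized eigenvalues. Furthermore, if this inequality holds and one sets $\epsilon=\|\mathcal{T}-\mathcal{Y}\|_{\mathrm{sp}}$, then the generalized eigenvalues of $\mathcal{Y}$ may be divided into $J$ nonempty sets $\{\mathscr{L}^j\}_{j=1}^J$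 such that $$\min_{j\neq\ell}\chi(\mathscr{L}^j,\mathscr{L}^\ell)\ \ge\ 2\delta-\frac{2\epsilon}{\sigma_{\min}(\mathbf{A})\,\sigma_{\min}(\mathbf{B})}\ >\ 0.$$
   Context: Let $\mathbb{K}$ be $\mathbb{R}$ or $\mathbb{C}$. For a tensor $\mathcal{M}\in\mathbb{K}^{R\times R\times K}$, the frontal slices are the matrices $\mathbf{M}_k=\mathcal{M}(:,:,k)\in\mathbb{K}^{R\times R}$, $k=1,\dots,K$. For a matrix $\mathbf{U}\in\mathbb{K}^{L\times K}$, the mode-3 product $\mathcal{M}\cdot_3\mathbf{U}\in\mathbb{K}^{R\times R\times L}$ is the tensor whose $\ell$th frontal slice is $\sum_{k}u_{\ell k}\mathbf{M}_k$; the mode-1 and mode-2 products $\cdot_1,\cdot_2$ are defined analogously in the first and second index. A tensor $\mathcal{M}$ is slice mix invertible if some linear combination $\mathcal{M}\cdot_3\mathbf{v}^{\mathrm T}=\sum_k v_k\mathbf{M}_k$ with $\mathbf{v}\in\mathbb{R}^K$ is an invertible matrix. A pencil is a tensor of size $R\times R\times 2$; here all tensors, including the pencils considered in the definition of $\epsilon_2$, are real. $[\![\mathbf{A},\mathbf{B},\mathbf{C}]\!]=\sum_{r=1}^R \mathbf{a}_r\otimes\mathbf{b}_r\otimes\mathbf{c}_r$ denotes the tensor with $(i,j,k)$ entry $\sum_r a_{ir}b_{jr}c_{kr}$, where $\mathbf{a}_r,\mathbf{b}_r,\mathbf{c}_r$ are the $r$th columns of $\mathbf{A},\mathbf{B},\mathbf{C}$.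 The $\mathbb{K}$-rank (real rank if $\mathbb{K}=\mathbb{R}$) of a tensor is the minimal $R$ for which it can be so written with factors over $\mathbb{K}$, and such a minimal expression is a canonical polyadic decomposition (CPD). Generalized eigenvalues: for a pencil $\mathcal{M}$, a one-dimensional subspace $\mathrm{span}(\lambda)\subset\mathbb{K}^2$ is a generalized eigenvalue (over $\mathbb{K}$) if there are nonzero $\mathbf{z},\mathbf{q}\in\mathbb{K}^R$ with $\mathbf{M}_k\mathbf{z}=\lambda_k\mathbf{q}$ for $k=1,2$. ''Possibly complex valued'' generalized eigenvalues are those with $\mathbb{K}=\mathbb{C}$. For a slice mix invertible real rank $R$ pencil $\mathcal{T}=[\![\mathbf{A},\mathbf{B},\mathbf{C}]\!]$ the generalized eigenvalues, listed with multiplicity, are the spans of the $R$ columns of $\mathbf{C}$. $\sigma_{\min}$ denotes the smallest singular value. $\mathrm{Gr}(1,\mathbb{K}^2)$ is the set of one-dimensional subspaces of $\mathbb{K}^2$. For a nonzero $\lambda\in\mathbb{R}^2$, $\theta(\lambda)\in[0,\pi)$ is the unique angle with $\mathrm{span}(\lambda)=\mathrm{span}\big((\cos\theta(\lambda),\sin\theta(\lambda))\big)$. The chordal metric $\chi$ on $\mathrm{Gr}(1,\mathbb{K}^2)$ is the sine of the principal angle between the two subspaces; for nonzero vectors, $\chi(\lambda,\mu):=\chi(\mathrm{span}(\lambda),\mathrm{span}(\mu))$. For finite nonempty sets $\mathscr{L},\mathscr{L}'\subset\mathrm{Gr}(1,\mathbb{C}^2)$, $\chi(\mathscr{L},\mathscr{L}')$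 is the minimum of $\chi(\mathfrak{l},\mathfrak{l}')$ over $\mathfrak{l}\in\mathscr{L},\mathfrak{l}'\in\mathscr{L}'$. The spectral norm of a real tensor $\mathcal{M}$ is $\|\mathcal{M}\|_{\mathrm{sp}}=\max_{\|\mathbf{x}\|_2=\|\mathbf{y}\|_2=\|\mathbf{z}\|_2=1}|\mathcal{M}\cdot_1\mathbf{x}^{\mathrm T}\cdot_2\mathbf{y}^{\mathrm T}\cdot_3\mathbf{z}^{\mathrm T}|$, the maximum being over real vectors $\mathbf{x},\mathbf{y},\mathbf{z}$ of compatible dimension. *)

(* Defs.v *)
From mathcomp Require Import all_boot all_order all_algebra.
From mathcomp Require Import perm complex.
From mathcomp Require Import all_classical all_reals all_analysis.

Set Implicit Arguments.
Unset Strict Implicit.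
Unset Printing Implicit Defensive.

Import Order.TTheory GRing.Theory Num.Theory.
Local Open Scope classical_set_scope.
Local Open Scope ring_scope.

(* A tensor of size m x p x k is the family of its frontal slices; entry
   (i, j, l) of M is M l i j. *)
Notation tensor F m p k := {ffun 'I_k -> 'M[F]_(m, p)}.

Definition mode1 {F : fieldType} {m p k q : nat}
    (M : tensor F m p k) (U : 'M[F]_(q, m)) : tensor F q p k :=
  [ffun l => U *m M l].

Definition mode2 {F : fieldType} {m p k q : nat}
    (M : tensor F m p k) (U : 'M[F]_(q, p)) : tensor F m q k :=
  [ffun l => M l *m U^T].

Definition mode3 {F : fieldType} {m p k q : nat}
    (M : tensor F m p k) (U : 'M[F]_(q, k)) : tensor F m p q :=
  [ffun l => \sum_(s < k) U l s *: M s].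

Definition slice_mix_invertible {F : fieldType} {n k : nat}
    (M : tensor F n n k) : Prop :=
  exists v : 'cV[F]_k, mode3 M v^T ord0 \in unitmx.

(* The tensor [[A, B, C]] = \sum_r a_r \otimes b_r \otimes c_r. *)
Definition cpd {F : fieldType} {m p k r : nat}
    (A : 'M[F]_(m, r)) (B : 'M[F]_(p, r)) (C : 'M[F]_(k, r)) : tensor F m p k :=
  [ffun l => \matrix_(i, j) \sum_(s < r) A i s * B j s * C l s].

Definition has_rank {F : fieldType} {m p k : nat}
    (M : tensor F m p k) (r : nat) : Prop :=
  (exists A : 'M[F]_(m, r), exists B : 'M[F]_(p, r), exists C : 'M[F]_(k, r),
     M = cpd A B C) /\
  (forall s (A : 'M[F]_(m, s)) (B : 'M[F]_(p, s)) (C : 'M[F]_(k, s)),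
     M = cpd A B C -> (r <= s)%N).

(* Elements of Gr(1, F^2) are the subspaces of dimension 1 of F^2. *)
Definition geneigs {F : fieldType} {n : nat} (M : tensor F n n 2) :
    set {vspace 'cV[F]_2} :=
  [set U | exists lam : 'cV[F]_2, exists z : 'cV[F]_n, exists q : 'cV[F]_n,
     [/\ lam != 0, U = <[lam]>%VS, z != 0, q != 0 &
         forall k : 'I_2, M k *m z = lam k ord0 *: q]].

(* lam lists, with multiplicity, the generalized eigenvalues of a pencil with
   third factor matrix C: up to order, these are the spans of the columns of C. *)
Definition lists_col_spans {F : fieldType} {n : nat}
    (lam : 'I_n -> 'cV[F]_2) (C : 'M[F]_(2, n)) : Prop :=
  exists s : 'S_n, forall r, <[lam r]>%VS = <[col (s r) C]>%VS.

(* The next notions are shared by F = R (conj = id, abs = absolute value) and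
   F = R[i] (conj = conjugation, abs = modulus with values in R). *)
Definition l2norm {R : realType} {F : fieldType} {n : nat}
    (abs : F -> R) (x : 'cV[F]_n) : R :=
  Num.sqrt (\sum_i abs (x i ord0) ^+ 2).

Definition inner {F : fieldType} {n : nat}
    (conj : F -> F) (x y : 'cV[F]_n) : F :=
  \sum_i x i ord0 * conj (y i ord0).

Definition principal_angle {R : realType} {F : fieldType}
    (conj : F -> F) (abs : F -> R) (U V : {vspace 'cV[F]_2}) : R :=
  acos (sup [set t | exists u, exists v,
    [/\ u \in U, v \in V, l2norm abs u = 1, l2norm abs v = 1 &
        t = abs (inner conj u v)]]).

Definition chordal {R : realType} {F : fieldType}
    (conj : F -> F) (abs : F -> R) (U V : {vspace 'cV[F]_2}) : R :=
  sin (principal_angle conj abs U V).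

Definition chordalR {R : realType} (U V : {vspace 'cV[R]_2}) : R :=
  chordal id Num.norm U V.

Definition chordalC {R : realType} (U V : {vspace 'cV[R[i]]_2}) : R :=
  chordal conjc (@ComplexField.Normc.normc R) U V.

(* On finite nonempty sets, the infimum is a minimum. *)
Definition chordalC_set {R : realType} (L L' : set {vspace 'cV[R[i]]_2}) : R :=
  inf [set t | exists U, exists V, [/\ L U, L' V & t = chordalC U V]].

Definition enorm {R : realType} {n : nat} (x : 'cV[R]_n) : R :=
  l2norm Num.norm x.

Definition spnorm {R : realType} {m p k : nat} (M : tensor R m p k) : R :=
  sup [set t | exists x, exists y, exists z,
    [/\ enorm x = 1, enorm y = 1, enorm z = 1 &
        t = `|mode3 (mode2 (mode1 M x^T) y^T) z^T ord0 ord0 ord0|]].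

(* Spectral norm distance to the set of non slice mix invertible pencils. *)
Definition dist_not_smi {R : realType} {n : nat} (M : tensor R n n 2) : R :=
  inf [set t | exists N : tensor R n n 2,
    ~ slice_mix_invertible N /\ t = spnorm (M - N)].

(* Singular values are the square roots of the eigenvalues of A^T A. *)
Definition sigma_min {R : realType} {n : nat} (A : 'M[R]_n) : R :=
  inf [set s | 0 <= s /\ eigenvalue (A^T *m A) (s ^+ 2)].

Definition theta {R : realType} (lam : 'cV[R]_2) : R :=
  get [set t | 0 <= t < pi /\
    <[lam]>%VS = <[\col_(i < 2) (if i == ord0 then cos t else sin t)]>%VS].

(* The J-th largest (J >= 1) of the half chordal distances between cyclically
   consecutive members of lam; ordS sends the last index to the first. *)
Definition Jth_half_gap {R : realType} {n : nat}
    (lam : 'I_n -> 'cV[R]_2) (J : nat) : R :=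
  nth 0 (sort >=%R [seq chordalR <[lam r]>%VS <[lam (ordS r)]>%VS / 2
                   | r : 'I_n]) J.-1.

Definition complexify {R : realType} {m p k : nat} (M : tensor R m p k) :
    tensor R[i] m p k :=
  [ffun l => map_mx (real_complex R) (M l)].

(* Main.v *)
Require Import Defs.
From mathcomp Require Import all_boot all_order all_algebra.
From mathcomp Require Import perm complex.
From mathcomp Require Import all_classical all_reals all_analysis.
From mathcomp Require Import ring lra.

Set Implicit Arguments.
Unset Strict Implicit.
Unset Printing Implicit Defensive.

Import Order.TTheory GRing.Theory Num.Theory.
Import numFieldNormedType.Exports.
Local Open Scope classical_set_scope.
Local Open Scope ring_scope.

(** Let [rho = eps / (sigma_min A * sigma_min B) < delta].  A Bauer-Fike argument
    places every generalized eigenvalue of [T - t (T - Y)], [0 <= t <= 1], near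
    some column of [C]: as the spectral norm is over real vectors while the
    eigenvalues may be complex, a direction [a + i b] with [a] orthogonal to [b]
    costs [|a| + |b|], the nuclear norm of [[a, b]], instead of its Euclidean
    norm.  On the Bloch sphere, the points near a column lie in the union of two
    spherical caps mirrored in the equator.  Despite the larger neighbourhoods,
    two columns at chordal distance [g] still have neighbourhoods at distance at
    least [g - 2 rho], because both caps lie in the same half-space
    perpendicular to the equator.

    The [J] gaps of size at least [2 delta] cut the columns into [J] clusters at
    mutual distance at least [2 delta].  The neighbourhoods of the clusters are
    thus pairwise separated, and no root of the characteristic polynomial can
    jump from one to another in a short step of the path from [T] to [Y];
    starting from a column of [C], every cluster keeps an eigenvalue. *)

(** * Euclidean norm and smallest singular value *)

Definition dot {F : pzRingType} {n : nat} (x y : 'cV[F]_n) : F :=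
  \sum_i x i ord0 * y i ord0.

Section DotProduct.
Variables (R : realType) (n : nat).
Implicit Types x y z : 'cV[R]_n.

Lemma dotC x y : dot x y = dot y x.
Proof. by apply: eq_bigr => i _; rewrite mulrC. Qed.

Lemma dotDl x y z : dot (x + y) z = dot x z + dot y z.
Proof. by rewrite -big_split /=; apply: eq_bigr => i _; rewrite mxE mulrDl. Qed.

Lemma dotZl (a : R) x y : dot (a *: x) y = a * dot x y.
Proof. by rewrite big_distrr /=; apply: eq_bigr => i _; rewrite mxE mulrA. Qed.

Lemma dotDr x y z : dot x (y + z) = dot x y + dot x z.
Proof. by rewrite dotC dotDl !(dotC x). Qed.

Lemma dotZr (a : R) x y : dot x (a *: y) = a * dot x y.
Proof. by rewrite dotC dotZl dotC. Qed.

Lemma dotNr x y : dot x (- y) = - dot x y.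
Proof. by rewrite -scaleN1r dotZr mulN1r. Qed.

Lemma dotNl x y : dot (- x) y = - dot x y.
Proof. by rewrite dotC dotNr dotC. Qed.

Lemma dotBl x y z : dot (x - y) z = dot x z - dot y z.
Proof. by rewrite dotDl dotNl. Qed.

Lemma dotBr x y z : dot x (y - z) = dot x y - dot x z.
Proof. by rewrite dotDr dotNr. Qed.

Lemma dot_ge0 x : 0 <= dot x x.
Proof. by apply: sumr_ge0 => i _; rewrite -expr2 sqr_ge0. Qed.

Lemma dot_eq0 x : (dot x x == 0) = (x == 0).
Proof.
apply/eqP/eqP => [xx|->]; last first.
  by rewrite /dot big1 // => i _; rewrite mxE mul0r.
apply/colP => i; rewrite mxE; apply/eqP; rewrite -sqrf_eq0 expr2.
move/eqP: xx; rewrite psumr_eq0; last by move=> j _; rewrite -expr2 sqr_ge0.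
by move=> /allP /(_ i); rewrite mem_index_enum => /(_ isT).
Qed.

Lemma dot_gt0 x : (0 < dot x x) = (x != 0).
Proof. by rewrite lt_neqAle dot_ge0 andbT eq_sym dot_eq0. Qed.

Lemma dotE x y : dot x y = (x^T *m y) ord0 ord0.
Proof. by rewrite !mxE; apply: eq_bigr => i _; rewrite mxE. Qed.

Lemma enorm_sqr x : enorm x ^+ 2 = dot x x.
Proof.
rewrite /enorm /l2norm sqr_sqrtr; last by apply: sumr_ge0 => i _; rewrite sqr_ge0.
by apply: eq_bigr => i _; rewrite real_normK ?num_real // expr2.
Qed.

Lemma enorm_ge0 x : 0 <= enorm x. Proof. exact: sqrtr_ge0. Qed.

Lemma enorm_eq1 x : (enorm x == 1) = (dot x x == 1).
Proof. by rewrite -enorm_sqr sqrp_eq1 // enorm_ge0. Qed.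

Lemma dot_cauchy x y : dot x y ^+ 2 <= dot x x * dot y y.
Proof.
have [->|y0] := eqVneq y 0.
  have d0 z : dot z 0 = 0 by rewrite /dot big1 // => i _; rewrite mxE mulr0.
  by rewrite !d0 mulr0 expr0n.
have y_gt0 : 0 < dot y y by rewrite dot_gt0.
have := dot_ge0 (dot y y *: x - dot x y *: y).
rewrite dotBl !dotBr !dotZl !dotZr (dotC y x) => h.
rewrite -(ler_pM2l y_gt0); lra.
Qed.

(** Minkowski's inequality in squared form, by Cauchy-Schwarz. *)
Lemma dot_addr_le x y (a b : R) : 0 <= a -> 0 <= b ->
  dot x x <= a ^+ 2 -> dot y y <= b ^+ 2 -> dot (x + y) (x + y) <= (a + b) ^+ 2.
Proof.
move=> a_ge0 b_ge0 xa yb.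
have xy : dot x y <= a * b.
  apply: le_trans (ler_norm _) _.
  rewrite -(@ler_pXn2r _ 2) ?nnegrE ?mulr_ge0 // real_normK ?num_real //.
  apply: le_trans (dot_cauchy x y) _; rewrite exprMn.
  by apply: ler_pM => //; exact: dot_ge0.
rewrite dotDl !dotDr (dotC y x); lra.
Qed.

End DotProduct.

Lemma dot_mull (R : realType) (m n : nat) (A : 'M[R]_(m, n)) u y :
  dot u (A *m y) = dot (A^T *m u) y.
Proof. by rewrite !dotE trmx_mul trmxK mulmxA. Qed.

Lemma continuous_sum_fun (R : realType) (T : topologicalType) (I : Type)
    (r : seq I) (f : I -> T -> R) :
  (forall i, continuous (f i)) -> continuous (fun x => \sum_(i <- r) f i x).
Proof.
move=> cf; apply: (@continuous_big R^o _ +%R 0 xpredT) => [|i _]; last exact: cf.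
exact: (@pseudometric_normed_Zmodule.add_continuous _ R^o).
Qed.

Section SigmaMin.
Variables (R : realType) (n : nat).
Implicit Types A : 'M[R]_n.

Lemma sigma_min_ge0 A : 0 <= sigma_min A.
Proof.
rewrite /sigma_min; set S := [set s | _].
(* The infimum of the empty set, as for [n = 0], is [0] by convention. *)
have [->|/set0P[s0 Ss0]] := eqVneq S set0; first by rewrite inf0.
by apply: lb_le_inf; [exists s0|move=> s []].
Qed.

(** The argument is a row vector, the form in which the extreme value theorem is applied below. *)
Lemma continuous_dot_mulmx A :
  continuous (fun v : 'rV[R]_n => dot (A *m v^T) (A *m v^T)).
Proof.
have cA i : continuous (fun v : 'rV[R]_n => (A *m v^T) i ord0).
  have -> : (fun v : 'rV[R]_n => (A *m v^T) i ord0) =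
      (fun v : 'rV[R]_n => \sum_j A i j * v ord0 j).
    by apply/funext => v; rewrite mxE; apply: eq_bigr => j _; rewrite mxE.
  apply: continuous_sum_fun => j v.
  apply: (@continuousM R _ (fun=> A i j) (fun v : 'rV[R]_n => v ord0 j)).
    exact: cst_continuous.
  exact: coord_continuous.
by apply: continuous_sum_fun => i v; apply: continuousM; exact: cA.
Qed.

Lemma compact_unit_sphere : compact [set v : 'rV[R]_n | dot v^T v^T = 1].
Proof.
apply: bounded_closed_compact.
  exists 1; split; first exact: num_real.
  move=> M M1 v /= v1; apply: le_trans (ltW M1).
  rewrite (_ : `|v| = mx_norm v) // mx_normrE; apply/bigmax_leP;
    split => //= -[i j] _ /=.
  rewrite ord1 -(@expr_le1 _ 2) // real_normK ?num_real // -v1.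
  rewrite /dot (bigD1 j) //= !mxE expr2 lerDl.
  by apply: sumr_ge0 => k _; rewrite -expr2 sqr_ge0.
pose f (v : 'rV[R]_n) : R := dot (1%:M *m v^T) (1%:M *m v^T).
have -> : [set v : 'rV[R]_n | dot v^T v^T = 1] = f @^-1` [set x | x = 1].
  by apply/seteqP; split => v /=; rewrite /f mul1mx.
apply: (@preimage_closed _ R^o f); last exact: closed_eq.
by move=> v _; exact: continuous_dot_mulmx.
Qed.

(* A minimizer of the Rayleigh quotient of [A^T *m A] is an eigenvector. *)
Lemma sigma_min_dot A (x : 'cV[R]_n) :
  sigma_min A ^+ 2 * dot x x <= dot (A *m x) (A *m x).
Proof.
have [->|x0] := eqVneq x 0.
  by rewrite mulmx0 /dot !big1 ?mulr0 // => i _; rewrite mxE mul0r.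
have unit_vec (y : 'cV[R]_n) : y != 0 ->
    dot ((Num.sqrt (dot y y))^-1 *: y) ((Num.sqrt (dot y y))^-1 *: y) = 1.
  move=> y0; rewrite dotZl dotZr mulrA -expr2 exprVn sqr_sqrtr ?dot_ge0 //.
  by rewrite mulVf // dot_eq0.
have [|c] := @EVT_min_rV R n (fun v => dot (A *m v^T) (A *m v^T)) _ _
    compact_unit_sphere (continuous_subspaceT (@continuous_dot_mulmx A)).
  by exists ((Num.sqrt (dot x x))^-1 *: x)^T; rewrite /= trmxK unit_vec.
rewrite inE /= => c1 cmin.
set m := dot (A *m c^T) (A *m c^T) in cmin.
have le_m (y : 'cV[R]_n) : m * dot y y <= dot (A *m y) (A *m y).
  have [->|y0] := eqVneq y 0.
    by rewrite mulmx0 /dot !big1 ?mulr0 // => i _; rewrite mxE mul0r.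
  have := cmin ((Num.sqrt (dot y y))^-1 *: y)^T.
  rewrite inE /= trmxK unit_vec // => /(_ erefl).
  rewrite -scalemxAr dotZl dotZr mulrA -expr2 exprVn sqr_sqrtr ?dot_ge0 //.
  by rewrite mulrC ler_pdivlMr ?dot_gt0.
(* The residual [y] of the eigenvector equation has [B = dot y y], and minimality along [c^T + t y]
   reads [0 <= 2 t B + t^2 D]. At [t = - B / (D + 1)] the right-hand side is
   [- B^2 (D + 2) / (D + 1)^2], so [B = 0]; the [+ 1] covers [D = 0]. *)
have eig : A^T *m (A *m c^T) = m *: c^T.
  apply/eqP; rewrite -subr_eq0 -dot_eq0; set y := _ - _.
  have yE : dot y y = dot (A *m c^T) (A *m y) - m * dot c^T y.
    by rewrite {1}/y dotBl dotZl -dot_mull.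
  set B := dot y y in yE *.
  pose D := dot (A *m y) (A *m y) - m * B.
  have D_ge0 : 0 <= D by rewrite subr_ge0 le_m.
  have D1 : D + 1 != 0 by rewrite gt_eqF // ltr_wpDl.
  have := le_m (c^T + (- B / (D + 1)) *: y).
  rewrite mulmxDr -scalemxAr !dotDl !dotDr !dotZl !dotZr c1 -/m.
  rewrite (dotC (A *m y) (A *m c^T)) (dotC y c^T).
  rewrite -subr_ge0; set u := (X in 0 <= X).
  have -> : u = - (B ^+ 2 * ((D + 2) / (D + 1) ^+ 2)).
    have qE : dot (A *m c^T) (A *m y) = B + m * dot c^T y by rewrite yE; ring.
    have rE : dot (A *m y) (A *m y) = D + m * B by rewrite /D; ring.
    by rewrite /u qE rE -/B; move: D1; clearbody D B m; move=> D1; field.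
  rewrite oppr_ge0 pmulr_lle0; last by rewrite divr_gt0 ?exprn_gt0 //; lra.
  by move=> B2; rewrite -sqrf_eq0 eq_le B2 sqr_ge0.
have m_ge0 : 0 <= m by exact: dot_ge0.
have : sigma_min A <= Num.sqrt m.
  apply: ge_inf; first by exists 0 => s [].
  split; first exact: sqrtr_ge0.
  rewrite sqr_sqrtr //; apply/eigenvalueP; exists c.
    by apply: trmx_inj; rewrite trmx_mul [RHS]linearZ /= -eig !trmx_mul trmxK mulmxA.
  by rewrite -trmx_eq0 -dot_eq0 c1 oner_eq0.
rewrite -(@ler_pXn2r _ 2) ?nnegrE ?sqrtr_ge0 ?sigma_min_ge0 // sqr_sqrtr // => s_le.
by apply: le_trans (le_m x); rewrite ler_wpM2r ?dot_ge0.
Qed.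

(** If [sigma_min A] is positive, [A] is invertible and [x = A *m w]. Cauchy-Schwarz for
    [dot x x = dot (A^T *m x) w] is then combined with the bound of [|w|] by [|x| / sigma_min A]. *)
Lemma sigma_min_trmx_dot A (x : 'cV[R]_n) :
  sigma_min A ^+ 2 * dot x x <= dot (A^T *m x) (A^T *m x).
Proof.
have [->|s0] := eqVneq (sigma_min A) 0; first by rewrite expr0n mul0r dot_ge0.
have s_gt0 : 0 < sigma_min A by rewrite lt_neqAle eq_sym s0 sigma_min_ge0.
have A_unit : A \in unitmx.
  rewrite -unitmx_tr -row_free_unit; apply/inj_row_free => v vA.
  apply/trmx_inj/eqP; rewrite trmx0 -dot_eq0 eq_le dot_ge0 andbT.
  have := sigma_min_dot A v^T.
  have -> : A *m v^T = 0 by apply: trmx_inj; rewrite trmx_mul trmxK vA trmx0.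
  have -> : dot (0 : 'cV[R]_n) 0 = 0 by rewrite /dot big1 // => i _; rewrite mxE mul0r.
  by rewrite pmulr_rle0 // exprn_gt0.
pose w := invmx A *m x.
have xE : x = A *m w by rewrite /w mulKVmx.
have [x0|x_gt0] := leP (dot x x) 0.
  by apply: le_trans (dot_ge0 _); rewrite pmulr_rle0 ?exprn_gt0.
have := dot_cauchy (A^T *m x) w; rewrite -dot_mull -xE => cs.
have := sigma_min_dot A w; rewrite -xE => sw.
rewrite -(ler_pM2r x_gt0) -mulrA -expr2.
apply: le_trans (_ : sigma_min A ^+ 2 * (dot (A^T *m x) (A^T *m x) * dot w w) <= _).
  by rewrite ler_pM2l ?exprn_gt0.
by rewrite mulrCA ler_wpM2l ?dot_ge0.
Qed.

End SigmaMin.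

(** * Slice mixes and the spectral norm *)

(** The mode-3 product with [v^T], as a matrix instead of a tensor with a single slice. *)
Definition slice_mix {F : fieldType} {n k : nat} (M : tensor F n n k)
    (v : 'cV[F]_k) : 'M[F]_n := \sum_(s < k) v s ord0 *: M s.

Lemma slice_mixDr (F : fieldType) (n k : nat) (M : tensor F n n k) v w :
  slice_mix M (v + w) = slice_mix M v + slice_mix M w.
Proof. by rewrite -big_split /=; apply: eq_bigr => s _; rewrite mxE scalerDl. Qed.

Lemma slice_mixZr (F : fieldType) (n k : nat) (M : tensor F n n k) (a : F) v :
  slice_mix M (a *: v) = a *: slice_mix M v.
Proof. by rewrite scaler_sumr; apply: eq_bigr => s _; rewrite mxE scalerA. Qed.

Lemma slice_mixBl (F : fieldType) (n k : nat) (M N : tensor F n n k) v :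
  slice_mix (M - N) v = slice_mix M v - slice_mix N v.
Proof. by rewrite -sumrB; apply: eq_bigr => s _; rewrite !ffunE scalerBr. Qed.

Lemma slice_mixZl (F : fieldType) (n k : nat) (M : tensor F n n k) (a : F) v :
  slice_mix (a *: M) v = a *: slice_mix M v.
Proof.
rewrite scaler_sumr; apply: eq_bigr => s _.
by rewrite ffunE !scalerA mulrC.
Qed.

(** The same [A] and [B] diagonalize every slice mix, so a mix in a direction orthogonal to a column
    of [C] is singular. *)
Lemma slice_mix_cpd (F : fieldType) (n k : nat) (A B : 'M[F]_n)
    (C : 'M[F]_(k, n)) (v : 'cV[F]_k) :
  slice_mix (cpd A B C) v = A *m diag_mx (\row_r dot (col r C) v) *m B^T.
Proof.
apply/matrixP => i j; rewrite mul_mx_diag summxE mxE.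
under eq_bigr do rewrite !mxE ffunE mxE big_distrr /=.
rewrite exchange_big /=; apply: eq_bigr => r _.
rewrite !mxE big_distrr big_distrl /=; apply: eq_bigr => s _.
by rewrite !mxE; ring.
Qed.

Section SpectralNorm.
Variables (R : realType) (n : nat).
Implicit Types (E : tensor R n n 2) (x y : 'cV[R]_n) (v : 'cV[R]_2).

Lemma spnorm_ge0 E : 0 <= spnorm E.
Proof.
rewrite /spnorm; set S := [set t | _].
have S_ge0 t : S t -> 0 <= t by move=> [x [y [z [_ _ _ ->]]]].
(* A set without a supremum, such as the empty one for [n = 0], gets the value [0]. *)
have [[[t St] ubS]|/sup_out->//] := pselect (has_sup S).
by apply: le_trans (S_ge0 t St) _; apply: sup_upper_bound => //; split => //; exists t.
Qed.

Lemma tensor_formE E x y v :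
  mode3 (mode2 (mode1 E x^T) y^T) v^T ord0 ord0 ord0 = dot x (slice_mix E v *m y).
Proof.
rewrite dotE ffunE mulmxA mulmx_sumr mulmx_suml !summxE.
apply: eq_bigr => s _; rewrite !ffunE trmxK.
by rewrite -scalemxAr -scalemxAl !mxE.
Qed.

Lemma dot_le_spnorm E x y v : dot x x = 1 -> dot y y = 1 -> dot v v = 1 ->
  `|dot x (slice_mix E v *m y)| <= spnorm E.
Proof.
have enorm1 m (z : 'cV[R]_m) : dot z z = 1 <-> enorm z = 1.
  by split => /eqP; [rewrite -enorm_eq1 => /eqP|rewrite enorm_eq1 => /eqP].
have coord_le1 m (z : 'cV[R]_m) i : dot z z = 1 -> `|z i ord0| <= 1.
  move=> z1; rewrite -(@expr_le1 _ 2) // real_normK ?num_real // -z1.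
  rewrite /dot (bigD1 i) //= expr2 lerDl.
  by apply: sumr_ge0 => k _; rewrite -expr2 sqr_ge0.
move=> x1 y1 v1; apply: sup_upper_bound; last first.
  by exists x, y, v; split; rewrite -?enorm1 // tensor_formE.
split; first by exists `|dot x (slice_mix E v *m y)|, x, y, v;
  split; rewrite -?enorm1 // tensor_formE.
(* Unit vectors have entries of modulus at most [1], so the sum of the moduli of all entries of [E]
   bounds the trilinear form; the supremum is therefore a genuine one. *)
exists (\sum_i \sum_j \sum_s `|E s i j|) => _ [x' [y' [v' [/enorm1 x'1 /enorm1 y'1
  /enorm1 v'1 ->]]]].
rewrite tensor_formE; apply: le_trans (ler_norm_sum _ _ _) _.
apply: ler_sum => i _; rewrite normrM -[leRHS]mul1r.
apply: ler_pM => //; first exact: coord_le1.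
rewrite mxE; apply: le_trans (ler_norm_sum _ _ _) _.
apply: ler_sum => j _; rewrite normrM -[leRHS]mulr1.
apply: ler_pM => //; last exact: coord_le1.
rewrite summxE; apply: le_trans (ler_norm_sum _ _ _) _.
apply: ler_sum => s _; rewrite mxE normrM -[leRHS]mul1r.
by apply: ler_pM => //; exact: coord_le1.
Qed.

(** The trilinear form is tested on the normalized [w], [y] and [v], where [w] is the image itself;
    this gives an operator norm bound for every slice mix. *)
Lemma slice_mix_spnorm E y v :
  dot (slice_mix E v *m y) (slice_mix E v *m y) <=
    spnorm E ^+ 2 * dot v v * dot y y.
Proof.
have rhs_ge0 : 0 <= spnorm E ^+ 2 * dot v v * dot y y.
  by apply: mulr_ge0; [apply: mulr_ge0; [exact: sqr_ge0|]|]; exact: dot_ge0.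
set w := slice_mix E v *m y.
have [w0|w0] := eqVneq w 0.
  by have /eqP -> : dot w w == 0 by rewrite dot_eq0 w0.
have v0 : v != 0.
  apply: contraNneq w0 => v0; rewrite /w /slice_mix big1 ?mul0mx // => s _.
  by rewrite v0 mxE scale0r.
have y0 : y != 0 by apply: contraNneq w0 => y0; rewrite /w y0 mulmx0.
have unit m (z : 'cV[R]_m) : z != 0 -> dot ((enorm z)^-1 *: z) ((enorm z)^-1 *: z) = 1.
  move=> z0; rewrite dotZl dotZr mulrA -expr2 exprVn enorm_sqr mulVf //.
  by rewrite dot_eq0.
have norm_gt0 m (z : 'cV[R]_m) : z != 0 -> 0 < enorm z.
  by move=> z0; rewrite lt_neqAle enorm_ge0 andbT eq_sym -sqrf_eq0 enorm_sqr dot_eq0.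
have := dot_le_spnorm E (unit _ _ w0) (unit _ _ y0) (unit _ _ v0).
rewrite slice_mixZr -scalemxAr -scalemxAl -/w !dotZl !dotZr -enorm_sqr.
move: (norm_gt0 _ _ w0) (norm_gt0 _ _ y0) (norm_gt0 _ _ v0).
move: (enorm w) (enorm_sqr w) (enorm y) (enorm_sqr y)
  (enorm v) (enorm_sqr v) => ew wE ey yE ev vE ew_gt0 ey_gt0 ev_gt0.
have -> : ew^-1 * (ey^-1 * (ev^-1 * ew ^+ 2)) = ew / (ey * ev).
  by field; rewrite ?gt_eqF.
rewrite ger0_norm; last by rewrite divr_ge0 ?mulr_ge0 // ltW.
rewrite ler_pdivrMr ?mulr_gt0 // => le.
rewrite -yE -vE -mulrA -!exprMn (mulrC ev) ler_pXn2r ?nnegrE //.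
  exact: ltW.
by rewrite !mulr_ge0 ?spnorm_ge0 // ltW.
Qed.

End SpectralNorm.

(** * Bauer-Fike bound *)

(** The determinant of the matrix with columns [x] and [y]. Over the real or complex numbers, its
    modulus divided by the two norms is the chordal distance of the lines. *)
Definition wedge {F : pzRingType} (x y : 'cV[F]_2) : F :=
  x ord0 ord0 * y ord_max ord0 - x ord_max ord0 * y ord0 ord0.

(* The direction of the slice mix that is singular along the generalized
   eigenvalue [x]. *)
Definition perp {F : pzRingType} (x : 'cV[F]_2) : 'cV[F]_2 :=
  \col_i (if i == ord0 then - x ord_max ord0 else x ord0 ord0).

Lemma big_ord2 (V : nmodType) (f : 'I_2 -> V) : \sum_i f i = f ord0 + f ord_max.
Proof. by rewrite big_ord_recl big_ord1; congr (_ + f _); apply/val_inj. Qed.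

Lemma dot2E (F : pzRingType) (x y : 'cV[F]_2) :
  dot x y = x ord0 ord0 * y ord0 ord0 + x ord_max ord0 * y ord_max ord0.
Proof. by rewrite /dot big_ord2. Qed.

Lemma perp0E (F : pzRingType) (x : 'cV[F]_2) : perp x ord0 ord0 = - x ord_max ord0.
Proof. by rewrite mxE. Qed.

Lemma perp1E (F : pzRingType) (x : 'cV[F]_2) : perp x ord_max ord0 = x ord0 ord0.
Proof. by rewrite mxE. Qed.

Lemma dot_perp (R : realType) (x y : 'cV[R]_2) : dot (perp x) (perp y) = dot x y.
Proof. by rewrite !dot2E !perp0E !perp1E; ring. Qed.

Lemma dot_perpr (R : realType) (x y : 'cV[R]_2) : dot x (perp y) = - wedge x y.
Proof. by rewrite dot2E perp0E perp1E /wedge; ring. Qed.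

(** Lagrange's identity in the plane. *)
Lemma wedge_sqr (R : realType) (x y : 'cV[R]_2) :
  wedge x y ^+ 2 = dot x x * dot y y - dot x y ^+ 2.
Proof. by rewrite !dot2E /wedge; ring. Qed.

Lemma dot_col_mx (R : realType) (m n : nat) (x x' : 'cV[R]_m) (y y' : 'cV[R]_n) :
  dot (col_mx x y) (col_mx x' y') = dot x x' + dot y y'.
Proof. by rewrite !dotE tr_col_mx mul_row_col mxE. Qed.

Section BauerFike.
Variables (R : realType) (n : nat).
Variables (A B : 'M[R]_n) (C : 'M[R]_(2, n)) (E : tensor R n n 2) (e : R).
Hypothesis e_ge0 : 0 <= e.
Hypothesis E_le : forall (v : 'cV[R]_2) (y : 'cV[R]_n),
  dot (slice_mix E v *m y) (slice_mix E v *m y) <= e ^+ 2 * dot v v * dot y y.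

(* The equations say that [slice_mix (cpd A B C - E) (a + i b)] annihilates
   [x + i y]. *)
Lemma bauer_fike_real (a b : 'cV[R]_2) (x y : 'cV[R]_n) :
    (x != 0) || (y != 0) ->
    slice_mix (cpd A B C - E) a *m x = slice_mix (cpd A B C - E) b *m y ->
    slice_mix (cpd A B C - E) a *m y = - (slice_mix (cpd A B C - E) b *m x) ->
  exists r, (sigma_min A * sigma_min B) ^+ 2 *
      (dot (col r C) a ^+ 2 + dot (col r C) b ^+ 2) <=
    e ^+ 2 * (enorm a + enorm b) ^+ 2.
Proof.
move=> xy eqx eqy.
set T := cpd A B C in eqx eqy.
pose N := dot x x + dot y y.
have N_gt0 : 0 < N.
  case/orP: xy; rewrite -dot_gt0 => h; first by rewrite ltr_wpDr ?dot_ge0.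
  by rewrite ltr_wpDl ?dot_ge0.
have N_ge0 := ltW N_gt0.
(* [P] and [Q] are the real and imaginary parts of the mix of [T] along [a + i b] applied to
   [x + i y]; by the hypotheses, [E] gives the same vector. *)
pose P := slice_mix T a *m x - slice_mix T b *m y.
pose Q := slice_mix T a *m y + slice_mix T b *m x.
have PE : P = slice_mix E a *m x - slice_mix E b *m y.
  move: eqx; rewrite !slice_mixBl !mulmxBl /P => h.
  move: h; move: (_ *m _) (_ *m _) (_ *m _) (_ *m _) => t1 e1 t2 e2 h.
  by apply/colP => i; move/colP: h => /(_ i); rewrite !mxE; lra.
have QE : Q = slice_mix E a *m y + slice_mix E b *m x.
  move: eqy; rewrite !slice_mixBl !mulmxBl /Q => h.
  move: h; move: (_ *m _) (_ *m _) (_ *m _) (_ *m _) => t1 e1 t2 e2 h.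
  by apply/colP => i; move/colP: h => /(_ i); rewrite !mxE; lra.
have upper : dot P P + dot Q Q <= e ^+ 2 * (enorm a + enorm b) ^+ 2 * N.
  (* Terms are grouped by [a] and [b], not by real and imaginary part, so that the triangle
     inequality costs [enorm a + enorm b]. *)
  pose X := col_mx (slice_mix E a *m x) (slice_mix E a *m y).
  pose Y := col_mx (- (slice_mix E b *m y)) (slice_mix E b *m x).
  have -> : dot P P + dot Q Q = dot (X + Y) (X + Y).
    by rewrite add_col_mx dot_col_mx PE QE.
  have sN_ge0 : 0 <= e * Num.sqrt N by rewrite mulr_ge0 ?sqrtr_ge0.
  have -> : e ^+ 2 * (enorm a + enorm b) ^+ 2 * N =
     (enorm a * (e * Num.sqrt N) + enorm b * (e * Num.sqrt N)) ^+ 2.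
    by rewrite -mulrDl exprMn [(e * _) ^+ 2]exprMn sqr_sqrtr //; ring.
  apply: dot_addr_le; rewrite ?mulr_ge0 ?enorm_ge0 //.
    rewrite dot_col_mx !exprMn enorm_sqr sqr_sqrtr //.
    have := E_le a x; have := E_le a y; rewrite /N; lra.
  rewrite dot_col_mx !exprMn enorm_sqr sqr_sqrtr // dotNl dotNr opprK.
  have := E_le b x; have := E_le b y; rewrite /N; lra.
(* [f r] is the squared modulus of the diagonal entry [r] of the middle factor of the mix along
   [a + i b]; the required column minimizes it. *)
pose f r := dot (col r C) a ^+ 2 + dot (col r C) b ^+ 2.
have [r0 _] : exists r0 : 'I_n, true.
  have [n0|n_gt0] := posnP n; last by exists (Ordinal n_gt0).
  move: N_gt0; rewrite /N /dot !big1 ?addr0 ?ltxx // => i _;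
    by move: (ltn_ord i); rewrite {2}n0.
have [r _ r_min] := @Order.TotalTheory.arg_minP _ R 'I_n r0 xpredT f isT.
exists r; rewrite -(ler_pM2r N_gt0); apply: le_trans upper.
pose Da := diag_mx (\row_s dot (col s C) a).
pose Db := diag_mx (\row_s dot (col s C) b).
pose u := B^T *m x; pose w := B^T *m y.
have PA : P = A *m (Da *m u - Db *m w).
  by rewrite /P !slice_mix_cpd -!mulmxA -mulmxBr.
have QA : Q = A *m (Da *m w + Db *m u).
  by rewrite /Q !slice_mix_cpd -!mulmxA -mulmxDr.
have diagE (v : 'cV[R]_2) (z : 'cV[R]_n) i :
    (diag_mx (\row_s dot (col s C) v) *m z) i ord0 = dot (col i C) v * z i ord0.
  by rewrite mul_diag_mx !mxE.
(* Entry by entry, the modulus of a product of complex numbers is the product of the moduli. *)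
have lower : f r * (dot u u + dot w w) <=
    dot (Da *m u - Db *m w) (Da *m u - Db *m w) +
    dot (Da *m w + Db *m u) (Da *m w + Db *m u).
  have -> : dot (Da *m u - Db *m w) (Da *m u - Db *m w) +
      dot (Da *m w + Db *m u) (Da *m w + Db *m u) =
      \sum_i f i * (u i ord0 ^+ 2 + w i ord0 ^+ 2).
    rewrite -big_split /=; apply: eq_bigr => i _.
    have -> : (Da *m u - Db *m w) i ord0 =
        dot (col i C) a * u i ord0 - dot (col i C) b * w i ord0.
      by rewrite mxE [X in _ + X]mxE !diagE.
    have -> : (Da *m w + Db *m u) i ord0 =
        dot (col i C) a * w i ord0 + dot (col i C) b * u i ord0.
      by rewrite mxE !diagE.
    by rewrite /f; ring.
  rewrite -big_split big_distrr /=; apply: ler_sum => i _.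
  by rewrite -!expr2 ler_wpM2r ?addr_ge0 ?sqr_ge0 // r_min.
rewrite PA QA; apply: le_trans (lerD (sigma_min_dot A _) (sigma_min_dot A _)).
rewrite -mulrDr; apply: le_trans (ler_wpM2l (sqr_ge0 _) lower).
rewrite -/(f r) (_ : (sigma_min A * sigma_min B) ^+ 2 * f r * N =
  sigma_min A ^+ 2 * (f r * (sigma_min B ^+ 2 * N))); last by ring.
apply: ler_wpM2l; first exact: sqr_ge0.
apply: ler_wpM2l; first by apply: addr_ge0; exact: sqr_ge0.
by rewrite /N mulrDr; apply: lerD; exact: sigma_min_trmx_dot.
Qed.

End BauerFike.

(** * Separation on the Bloch sphere *)

(* The cap condition on the Bloch sphere says that [x] is close to the equatorial
   point [p]; [p - q] is the normal of the separating half-spaces.  With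
   [t = x . (p - q) / 2g], Cauchy-Schwarz turns the condition into a quadratic
   inequality in [t]. *)
Lemma bloch_halfspace_unit (R : realFieldType)
    (p1 p2 q1 q2 x1 x2 x3 g rho : R) :
    p1 ^+ 2 + p2 ^+ 2 = 1 -> q1 ^+ 2 + q2 ^+ 2 = 1 ->
    p1 * q1 + p2 * q2 = 1 - 2 * g ^+ 2 ->
    0 < g -> g <= 1 -> 0 <= rho -> 2 * rho <= g ->
    x1 ^+ 2 + x2 ^+ 2 + x3 ^+ 2 = 1 ->
    1 - (p1 * x1 + p2 * x2) <= 2 * rho ^+ 2 * (1 + `|x3|) ->
  2 * g * (g - 2 * rho) <= x1 * (p1 - q1) + x2 * (p2 - q2).
Proof.
move=> p_unit q_unit pq g_gt0 g_le1 rho_ge0 rho_le x_unit.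
have : `|x3| ^+ 2 = x3 ^+ 2 by rewrite real_normK // num_real.
have : 0 <= `|x3| by [].
move: `|x3| => z z_ge0 zE xp.
set h := g - 2 * rho.
pose t := (x1 * (p1 - q1) + x2 * (p2 - q2)) / (2 * g).
(* In the equatorial plane [p - q] and [p + q] are orthogonal, with squared lengths [4 g^2] and
   [4 (1 - g^2)]. So [t] is the coordinate along [p - q], [p . x = g t + w], and [wE] is
   Pythagoras. *)
pose w := (x1 * (p1 + q1) + x2 * (p2 + q2)) / 2.
have g_neq0 : g != 0 by rewrite gt_eqF.
have tE : x1 * (p1 - q1) + x2 * (p2 - q2) = 2 * g * t by rewrite /t; field.
rewrite tE ler_pM2l; last by lra.
have wE : w ^+ 2 = (1 - g ^+ 2) * (1 - z ^+ 2 - t ^+ 2).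
  have wE1 : w ^+ 2 * (16 * g ^+ 2) + (2 * g * t) ^+ 2 * (4 * (1 - g ^+ 2)) =
      16 * g ^+ 2 * (1 - g ^+ 2) * (1 - z ^+ 2).
    have d1 : (p1 - q1) ^+ 2 + (p2 - q2) ^+ 2 = 4 * g ^+ 2 by lra.
    have d2 : (p1 + q1) ^+ 2 + (p2 + q2) ^+ 2 = 4 * (1 - g ^+ 2) by lra.
    have d3 : (p1 + q1) * (p1 - q1) + (p2 + q2) * (p2 - q2) = 0 by lra.
    have -> : 16 * g ^+ 2 * (1 - g ^+ 2) * (1 - z ^+ 2) =
      (4 * g ^+ 2) * (4 * (1 - g ^+ 2)) * (x1 ^+ 2 + x2 ^+ 2).
      have -> : x1 ^+ 2 + x2 ^+ 2 = 1 - z ^+ 2 by lra.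
      by ring.
    rewrite -tE.
    have -> : w ^+ 2 * (16 * g ^+ 2) = 4 * w ^+ 2 * (4 * g ^+ 2) by ring.
    rewrite -d2 -d1.
    have -> : 4 * w ^+ 2 = (x1 * (p1 + q1) + x2 * (p2 + q2)) ^+ 2.
      by rewrite /w; field.
    move: d3; move: (p1 + q1) (p1 - q1) (p2 + q2) (p2 - q2) => a b c d abcd.
    apply/eqP; rewrite -subr_eq0; apply/eqP.
    transitivity (- (a * b + c * d) * ((a*b + c*d) * (x1 ^+ 2 + x2 ^+ 2)
       - 2 * (x1 * a + x2 * c) * (x1 * b + x2 * d))).
      by ring.
    by rewrite abcd oppr0 mul0r.
  apply: (mulfI (_ : 16 * g ^+ 2 != 0));
    first by rewrite mulf_neq0 ?expf_neq0 ?pnatr_eq0.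
  by rewrite mulrC; lra.
have xp' : 1 - 2 * rho ^+ 2 - g * t <= w + 2 * rho ^+ 2 * z.
  have -> : w + 2 * rho ^+ 2 * z = (p1 * x1 + p2 * x2 - g * t) + 2 * rho ^+ 2 * z.
    by rewrite /w /t; field.
  lra.
rewrite leNgt; apply/negP => t_lt.
(* For [g = 1] the vector [p + q] vanishes and [wE] does not constrain [t]; Cauchy-Schwarz with
   [p - q] replaces it. *)
have S_ge0 : 0 <= 1 - z ^+ 2 - t ^+ 2.
  have [g1|g1] := eqVneq g 1; last first.
    have : 0 < 1 - g ^+ 2 by nra.
    by move=> G; rewrite -(pmulr_rge0 _ G) -wE sqr_ge0.
  have t0 : (2 * g * t) ^+ 2 <= 4 * g ^+ 2 * (x1 ^+ 2 + x2 ^+ 2).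
    have <- : (p1 - q1) ^+ 2 + (p2 - q2) ^+ 2 = 4 * g ^+ 2 by lra.
    rewrite -tE -subr_ge0.
    set u := (X in 0 <= X).
    have -> : u = (x1 * (p2 - q2) - x2 * (p1 - q1)) ^+ 2 by rewrite /u; ring.
    exact: sqr_ge0.
  have : 4 * g ^+ 2 * t ^+ 2 <= 4 * g ^+ 2 * (1 - z ^+ 2) by nra.
  rewrite ler_pM2l; first by lra.
  by rewrite mulr_gt0 // exprn_gt0.
have lhs_ge0 : 0 <= 1 - 2 * rho ^+ 2 - g * t.
  have gt_lt : g * t <= g * h by rewrite ler_pM2l // ltW.
  have : 0 <= rho * (g - 2 * rho) by rewrite mulr_ge0 //; lra.
  have : g ^+ 2 <= 1 by rewrite expr_le1 // ltW.
  rewrite /h in gt_lt; nra.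
(* Cauchy-Schwarz for the pairs [(sqrt (1 - g^2), 2 rho^2)] and [(sqrt (1 - z^2 - t^2), z)]. *)
have cauchy : (w + 2 * rho ^+ 2 * z) ^+ 2 <=
    (1 - g ^+ 2 + 4 * rho ^+ 4) * (1 - t ^+ 2).
  rewrite -subr_ge0.
  set G := 1 - g ^+ 2 in wE *; set S := 1 - z ^+ 2 - t ^+ 2 in wE S_ge0.
  set k := 2 * rho ^+ 2.
  have G_ge0 : 0 <= G by rewrite /G; nra.
  have -> : (G + 4 * rho ^+ 4) * (1 - t ^+ 2) - (w + k * z) ^+ 2 =
     G * z ^+ 2 + k ^+ 2 * S - 2 * w * k * z.
    rewrite sqrrD wE /k /S; ring.
  rewrite subr_ge0.
  have k_ge0 : 0 <= k by rewrite /k mulr_ge0 ?sqr_ge0.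
  apply: le_trans (ler_norm _) _.
  rewrite -(@ler_pXn2r _ 2) ?nnegrE //; last by rewrite addr_ge0 ?mulr_ge0 ?sqr_ge0.
  rewrite real_normK ?num_real //.
  have -> : (2 * w * k * z) ^+ 2 = 4 * (G * S) * (k * z) ^+ 2.
    by rewrite -wE; ring.
  rewrite -subr_ge0.
  set u := (X in 0 <= X).
  have -> : u = (G * z ^+ 2 - k ^+ 2 * S) ^+ 2 by rewrite /u; ring.
  exact: sqr_ge0.
(* Squaring [xp'] gives [Q(t) <= 0] for a convex parabola [Q]. As [Q(h) >= 0] and [h] is not to the
   right of the vertex, [t < h] would force [Q(t) > 0]. *)
have Q_le0 : (1 + 4 * rho ^+ 4) * t ^+ 2 - 2 * g * (1 - 2 * rho ^+ 2) * t
    + g ^+ 2 - 4 * rho ^+ 2 <= 0.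
  have := ler_pM lhs_ge0 lhs_ge0 xp' xp'; rewrite -!expr2 => xp2.
  have := le_trans xp2 cauchy; lra.
have h_ge0 : 0 <= h by rewrite /h; lra.
have rho_le1 : rho <= 1 / 2 by lra.
have Qh_ge0 : 0 <= (1 + 4 * rho ^+ 4) * h ^+ 2 - 2 * g * (1 - 2 * rho ^+ 2) * h
    + g ^+ 2 - 4 * rho ^+ 2.
  set u := (X in 0 <= X).
  have -> : u = h * (4 * rho ^+ 4 * h + 4 * g * rho ^+ 2) by rewrite /u /h; ring.
  by rewrite mulr_ge0 // addr_ge0 // ?mulr_ge0 ?exprn_ge0 // ltW.
have vertex : (1 + 4 * rho ^+ 4) * h <= g * (1 - 2 * rho ^+ 2).
  rewrite -subr_ge0; set u := (X in 0 <= X).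
  have -> : u = 2 * rho * (1 + 4 * rho ^+ 4 - 2 * g * rho ^+ 3 - g * rho).
    by rewrite /u /h; ring.
  rewrite mulr_ge0 //; first by lra.
  have r2 : rho ^+ 2 <= 1 / 4 by nra.
  have r3 : rho ^+ 3 <= 1 / 8 by rewrite exprS; nra.
  have r3g : g * rho ^+ 3 <= 1 / 8.
    by rewrite -[leRHS]mul1r ler_pM ?exprn_ge0 // ltW.
  have rg : g * rho <= 1 / 2 by rewrite -[leRHS]mul1r ler_pM // ltW.
  have : 0 <= rho ^+ 4 by rewrite exprn_ge0.
  lra.
have K_gt0 : 0 < 1 + 4 * rho ^+ 4.
  have : 0 <= rho ^+ 4 by rewrite exprn_ge0.
  lra.
have lt2 : (1 + 4 * rho ^+ 4) * t < (1 + 4 * rho ^+ 4) * h by rewrite ltr_pM2l.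
(* The product is [Q(t) - Q(h)]. *)
have : 0 < (h - t) * (2 * (g * (1 - 2 * rho ^+ 2)) - (1 + 4 * rho ^+ 4) * h
   - (1 + 4 * rho ^+ 4) * t).
  by rewrite mulr_gt0 ?subr_gt0 //; lra.
lra.
Qed.

(** After scaling to the unit sphere, [x] and [y] lie in opposite half-spaces normal to [p - q], a
    vector of length [2 g]. So [x - y] has component at least [2 (g - 2 rho)] along it, and
    [|x - y|^2 = 2 - 2 x . y]. *)
Lemma bloch_separation (R : realFieldType)
    (p1 p2 q1 q2 x1 x2 x3 y1 y2 y3 m m' g rho : R) :
    p1 ^+ 2 + p2 ^+ 2 = 1 -> q1 ^+ 2 + q2 ^+ 2 = 1 ->
    p1 * q1 + p2 * q2 = 1 - 2 * g ^+ 2 ->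
    0 < g -> g <= 1 -> 0 <= rho -> 2 * rho <= g -> 0 < m -> 0 < m' ->
    x1 ^+ 2 + x2 ^+ 2 + x3 ^+ 2 = m ^+ 2 ->
    y1 ^+ 2 + y2 ^+ 2 + y3 ^+ 2 = m' ^+ 2 ->
    m - (p1 * x1 + p2 * x2) <= 2 * rho ^+ 2 * (m + `|x3|) ->
    m' - (q1 * y1 + q2 * y2) <= 2 * rho ^+ 2 * (m' + `|y3|) ->
  2 * (g - 2 * rho) ^+ 2 * (m * m') <= m * m' - (x1 * y1 + x2 * y2 + x3 * y3).
Proof.
move=> p_unit q_unit pq g_gt0 g_le1 rho_ge0 rho_le m_gt0 m'_gt0 xE yE xp yq.
wlog [mE m'E] : x1 x2 x3 y1 y2 y3 m m' m_gt0 m'_gt0 xE yE xp yq / m = 1 /\ m' = 1.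
  move=> unit_case.
  have m0 : m != 0 by rewrite gt_eqF.
  have m'0 : m' != 0 by rewrite gt_eqF.
  have := unit_case (x1 / m) (x2 / m) (x3 / m) (y1 / m') (y2 / m') (y3 / m') 1 1
    ltr01 ltr01.
  have -> : (x1 / m) ^+ 2 + (x2 / m) ^+ 2 + (x3 / m) ^+ 2 =
     (x1 ^+ 2 + x2 ^+ 2 + x3 ^+ 2) / m ^+ 2 by field.
  have -> : (y1 / m') ^+ 2 + (y2 / m') ^+ 2 + (y3 / m') ^+ 2 =
     (y1 ^+ 2 + y2 ^+ 2 + y3 ^+ 2) / m' ^+ 2 by field.
  have -> : 1 - (p1 * (x1 / m) + p2 * (x2 / m)) = (m - (p1 * x1 + p2 * x2)) / m.
    by field.
  have -> : 1 - (q1 * (y1 / m') + q2 * (y2 / m')) = (m' - (q1 * y1 + q2 * y2)) / m'.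
    by field.
  have -> : 2 * rho ^+ 2 * (1 + `|x3 / m|) = 2 * rho ^+ 2 * (m + `|x3|) / m.
    by rewrite normrM (gtr0_norm (_ : 0 < m^-1)) ?invr_gt0 //; field.
  have -> : 2 * rho ^+ 2 * (1 + `|y3 / m'|) = 2 * rho ^+ 2 * (m' + `|y3|) / m'.
    by rewrite normrM (gtr0_norm (_ : 0 < m'^-1)) ?invr_gt0 //; field.
  rewrite !ler_pM2r ?invr_gt0 // xE yE !divff ?expf_neq0 // expr1n.
  move=> /(_ erefl erefl xp yq (conj erefl erefl)).
  have mm'_gt0 : 0 < m * m' by rewrite mulr_gt0.
  rewrite -(ler_pM2r mm'_gt0).
  have -> : (1 * 1 - (x1 / m * (y1 / m') + x2 / m * (y2 / m') + x3 / m * (y3 / m')))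
     * (m * m') = m * m' - (x1 * y1 + x2 * y2 + x3 * y3) by field; rewrite m0 m'0.
  by rewrite !mulr1.
move: xE yE xp yq; rewrite mE m'E !mulr1 expr1n => xE yE xp yq.
have := bloch_halfspace_unit p_unit q_unit pq g_gt0 g_le1 rho_ge0 rho_le xE xp.
rewrite (mulrC p1) (mulrC p2) in pq.
have := bloch_halfspace_unit q_unit p_unit pq g_gt0 g_le1 rho_ge0 rho_le yE yq.
set h := g - 2 * rho => hy hx.
have h_ge0 : 0 <= h by rewrite /h; lra.
have lo : 4 * g * h <= (x1 - y1) * (p1 - q1) + (x2 - y2) * (p2 - q2) by lra.
have lo_ge0 : 0 <= 4 * g * h by do 2![apply: mulr_ge0 => //]; exact: ltW.
have := ler_pM lo_ge0 lo_ge0 lo lo; rewrite -!expr2 => sq.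
have cs : ((x1 - y1) * (p1 - q1) + (x2 - y2) * (p2 - q2)) ^+ 2 <=
   ((x1 - y1) ^+ 2 + (x2 - y2) ^+ 2 + (x3 - y3) ^+ 2) * (4 * g ^+ 2).
  have <- : (p1 - q1) ^+ 2 + (p2 - q2) ^+ 2 = 4 * g ^+ 2 by lra.
  rewrite -subr_ge0; set u := (X in 0 <= X).
  have -> : u = ((x1 - y1) * (p2 - q2) - (x2 - y2) * (p1 - q1)) ^+ 2 +
     (x3 - y3) ^+ 2 * ((p1 - q1) ^+ 2 + (p2 - q2) ^+ 2) by rewrite /u; ring.
  apply: addr_ge0; first exact: sqr_ge0.
  by apply: mulr_ge0; first exact: sqr_ge0; apply: addr_ge0; exact: sqr_ge0.
have := le_trans sq cs.
have -> : (4 * g * h) ^+ 2 = 4 * h ^+ 2 * (4 * g ^+ 2) by ring.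
rewrite ler_pM2r; last by rewrite mulr_gt0 // exprn_gt0.
lra.
Qed.

(** * Neighbourhoods of real lines in the complex projective line *)

Notation remx := (map_mx (@complex.Re _)).
Notation immx := (map_mx (@complex.Im _)).
Notation cmx := (map_mx (real_complex _)).

Section Complex.
Variable R : realType.
Local Notation C := R[i].

Definition sqmod {n : nat} (z : 'cV[C]_n) : R :=
  dot (remx z) (remx z) + dot (immx z) (immx z).

(* With [z = a + i b], the right-hand side is [rho ^ 2] times the square of the
   nuclear norm of the real matrix [[a, b]], i.e. of [|a| + |b|] once the phase
   of [z] makes [a] and [b] orthogonal. *)
Definition near (rho : R) (c : 'cV[R]_2) (z : 'cV[C]_2) : Prop :=
  wedge c (remx z) ^+ 2 + wedge c (immx z) ^+ 2 <=
    rho ^+ 2 * (sqmod z + 2 * `|wedge (remx z) (immx z)|).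

Lemma cmx_decomp (m n : nat) (z : 'M[C]_(m, n)) :
  z = cmx (remx z) + 'i%C *: cmx (immx z).
Proof. by apply/matrixP => i j; rewrite !mxE -complexE. Qed.

Lemma cmx_eq0 (m n : nat) (P Q : 'M[R]_(m, n)) :
  cmx P + 'i%C *: cmx Q = 0 -> P = 0 /\ Q = 0.
Proof.
move=> /matrixP PQ; split; apply/matrixP => i j; move: (PQ i j); rewrite !mxE;
  by move=> /eqP; rewrite eq_complex /=; simpc => /andP[/eqP ? /eqP ?].
Qed.

Lemma sqmod_gt0 n (z : 'cV[C]_n) : (0 < sqmod z) = (z != 0).
Proof.
have -> : (z != 0) = (remx z != 0) || (immx z != 0).
  rewrite -negb_and; congr (~~ _); apply/eqP/andP => [->|[/eqP re0 /eqP im0]].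
    by split; apply/eqP/matrixP => i j; rewrite !mxE.
  by rewrite [z]cmx_decomp re0 im0 !map_mx0 scaler0 addr0.
rewrite /sqmod -!dot_gt0.
have := dot_ge0 (remx z); have := dot_ge0 (immx z).
rewrite !le_eqVlt => /predU1P[<-|h1] /predU1P[<-|h2];
  rewrite ?addr0 ?add0r ?ltxx ?h1 ?h2 //.
by rewrite addr_gt0.
Qed.

(** Scaling by [w] multiplies both sides by [|w|^2], so [near] is a condition on the line spanned by
    [z]. *)
Lemma near_scale rho c (w : C) (z : 'cV[C]_2) : w != 0 ->
  near rho c (w *: z) -> near rho c z.
Proof.
case: w => p q w0.
have w_gt0 : 0 < p ^+ 2 + q ^+ 2.
  move: w0; rewrite eq_complex /= negb_and => /orP[h|h].
    by rewrite ltr_wpDr ?sqr_ge0 // exprn_even_gt0.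
  by rewrite ltr_wpDl ?sqr_ge0 // exprn_even_gt0.
have reE : remx ((p +i* q)%C *: z) = p *: remx z - q *: immx z.
  by apply/matrixP => i j; rewrite !mxE; case: (z i j).
have imE : immx ((p +i* q)%C *: z) = p *: immx z + q *: remx z.
  by apply/matrixP => i j; rewrite !mxE; case: (z i j) => a b /=; rewrite addrC.
rewrite /near /sqmod reE imE; move: (remx z) (immx z) => a b.
have -> : wedge (p *: a - q *: b) (p *: b + q *: a) = (p ^+ 2 + q ^+ 2) * wedge a b.
  by rewrite /wedge !mxE; ring.
rewrite normrM (gtr0_norm w_gt0).
have -> : wedge c (p *: a - q *: b) ^+ 2 + wedge c (p *: b + q *: a) ^+ 2 =
    (p ^+ 2 + q ^+ 2) * (wedge c a ^+ 2 + wedge c b ^+ 2).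
  by rewrite /wedge !mxE; ring.
have -> : dot (p *: a - q *: b) (p *: a - q *: b) +
    dot (p *: b + q *: a) (p *: b + q *: a) =
    (p ^+ 2 + q ^+ 2) * (dot a a + dot b b).
  by rewrite !dot2E !mxE; ring.
by rewrite [2 * (_ * _)]mulrCA -mulrDr mulrCA ler_pM2l.
Qed.

(* Multiply by a square root of the conjugate of [dot z z]. *)
Lemma orthogonal_phase (z : 'cV[C]_2) :
  exists2 w : C, w != 0 & dot (remx (w *: z)) (immx (w *: z)) = 0.
Proof.
(* The two parts of [u] are orthogonal exactly when the bilinear square [dot u u] is real, as
   [conjc s * s] is. *)
have dotE2 (u : 'cV[C]_2) : complex.Im (dot u u) = 2 * dot (remx u) (immx u).
  rewrite !dot2E !mxE; case: (u _ _) => a b; case: (u _ _) => c d /=; ring.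
pose s := dot z z.
have [s0|s0] := eqVneq s 0.
  exists 1; rewrite ?oner_eq0 // scale1r; apply/eqP.
  by rewrite -(@mulrI_eq0 _ 2) -?dotE2 -/s ?s0 //; apply/lregP; rewrite pnatr_eq0.
exists (sqrtc (conjc s)); first by rewrite sqrtc_eq0 conjc_eq0.
apply/eqP; rewrite -(@mulrI_eq0 _ 2); last by apply/lregP; rewrite pnatr_eq0.
rewrite -dotE2.
have -> : dot (sqrtc (conjc s) *: z) (sqrtc (conjc s) *: z) = conjc s * s.
  rewrite -[X in X * s]sqr_sqrtc /s !dot2E !mxE; ring.
by case: (s) => a b /=; apply/eqP; ring.
Qed.

(** The Hopf map sends [z = a + i b] to a vector of length [sqmod z] with vertical coordinate
    [2 wedge a b], and real vectors to the equator. Under it [near] becomes the cap condition, and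
    [sqmod y * sqmod z] minus the inner product of the images is [2 |wedge y z|^2]. *)
Lemma near_separated (c d : 'cV[R]_2) (rho : R) (y z : 'cV[C]_2) :
    dot c c = 1 -> dot d d = 1 -> 0 <= rho -> 2 * rho < `|wedge c d| ->
    y != 0 -> z != 0 -> near rho c y -> near rho d z ->
  (`|wedge c d| - 2 * rho) ^+ 2 * (sqmod y * sqmod z) <=
    complex.Re (wedge y z) ^+ 2 + complex.Im (wedge y z) ^+ 2.
Proof.
move=> c1 d1 rho_ge0 rho_lt y0 z0 ny nz.
have g_le1 : `|wedge c d| <= 1.
  rewrite -(@expr_le1 _ 2) // real_normK ?num_real // wedge_sqr c1 d1 mulr1.
  by rewrite gerBl sqr_ge0.
have gE : `|wedge c d| ^+ 2 = wedge c d ^+ 2 by rewrite real_normK ?num_real.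
rewrite -sqmod_gt0 in y0; rewrite -sqmod_gt0 in z0.
set g := `|wedge c d| in gE g_le1 rho_lt *.
have g_gt0 : 0 < g by apply: le_lt_trans rho_lt; rewrite mulr_ge0.
have bloch_wedge (u v : 'cV[R]_2) : (2 * u ord0 ord0 * u ord_max ord0) *
     (2 * v ord0 ord0 * v ord_max ord0) +
     (u ord0 ord0 ^+ 2 - u ord_max ord0 ^+ 2) *
     (v ord0 ord0 ^+ 2 - v ord_max ord0 ^+ 2) =
     dot u u * dot v v - 2 * wedge u v ^+ 2.
  by rewrite !dot2E /wedge; ring.
have bloch_near (u a b : 'cV[R]_2) : dot u u = 1 ->
   dot a a + dot b b - (2 * u ord0 ord0 * u ord_max ord0 *
      (2 * (a ord0 ord0 * a ord_max ord0 + b ord0 ord0 * b ord_max ord0)) +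
      (u ord0 ord0 ^+ 2 - u ord_max ord0 ^+ 2) *
      (a ord0 ord0 ^+ 2 - a ord_max ord0 ^+ 2 +
      (b ord0 ord0 ^+ 2 - b ord_max ord0 ^+ 2))) =
    2 * (wedge u a ^+ 2 + wedge u b ^+ 2).
  move=> u1.
  have -> : dot a a + dot b b = dot u u * (dot a a + dot b b) by rewrite u1 mul1r.
  by rewrite !dot2E /wedge; ring.
have := @bloch_separation R
  (2 * c ord0 ord0 * c ord_max ord0) (c ord0 ord0 ^+ 2 - c ord_max ord0 ^+ 2)
  (2 * d ord0 ord0 * d ord_max ord0) (d ord0 ord0 ^+ 2 - d ord_max ord0 ^+ 2)
  (2 * (remx y ord0 ord0 * remx y ord_max ord0 + immx y ord0 ord0 * immx y
    ord_max ord0))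
  (remx y ord0 ord0 ^+ 2 - remx y ord_max ord0 ^+ 2 +
     (immx y ord0 ord0 ^+ 2 - immx y ord_max ord0 ^+ 2))
  (2 * wedge (remx y) (immx y))
  (2 * (remx z ord0 ord0 * remx z ord_max ord0 + immx z ord0 ord0 * immx z
    ord_max ord0))
  (remx z ord0 ord0 ^+ 2 - remx z ord_max ord0 ^+ 2 +
     (immx z ord0 ord0 ^+ 2 - immx z ord_max ord0 ^+ 2))
  (2 * wedge (remx z) (immx z)) (sqmod y) (sqmod z) g rho.
rewrite !bloch_near // !normrM ger0_norm // => sep.
have : 2 * (g - 2 * rho) ^+ 2 * (sqmod y * sqmod z) <=
    2 * (complex.Re (wedge y z) ^+ 2 + complex.Im (wedge y z) ^+ 2).
  apply: le_trans (sep _ _ _ g_gt0 g_le1 rho_ge0 (ltW rho_lt) y0 z0 _ _ _ _) _.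
  - by have := bloch_wedge c c; rewrite c1 -!expr2 => ->; rewrite /wedge; ring.
  - by have := bloch_wedge d d; rewrite d1 -!expr2 => ->; rewrite /wedge; ring.
  - by rewrite bloch_wedge c1 d1 gE mulr1.
  - by rewrite /sqmod !dot2E /wedge; ring.
  - by rewrite /sqmod !dot2E /wedge; ring.
  - by rewrite -mulrA ler_pM2l.
  - by rewrite -mulrA ler_pM2l.
  - rewrite /sqmod !dot2E /wedge !mxE.
    case: (y _ _) => a0 b0; case: (y _ _) => a1 b1.
    case: (z _ _) => a2 b2; case: (z _ _) => a3 b3 /=.
    by rewrite le_eqVlt; apply/orP; left; apply/eqP; ring.
by rewrite -mulrA ler_pM2l.
Qed.

End Complex.

(** * Clusters of angles *)

Lemma ler_sin_pihalf (R : realType) (x y : R) :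
  0 <= x -> x <= y -> y <= pi / 2 -> sin x <= sin y.
Proof.
move=> x_ge0 xy y_le; have pi0 := pi_gt0 R.
rewrite leNgt ltr_sin -?leNgt // in_itv /=; apply/andP; split; lra.
Qed.

(** On [[0, pi]] the sine increases and then decreases, so its minimum over a subinterval is at an
    endpoint. *)
Lemma sin_ge_min (R : realType) (x y d : R) :
  0 <= x -> x <= d -> d <= y -> y <= pi -> Num.min (sin x) (sin y) <= sin d.
Proof.
move=> x_ge0 xd dy y_le; have pi0 := pi_gt0 R.
rewrite ge_min; have [d_le|d_gt] := leP d (pi / 2).
  by rewrite ler_sin_pihalf.
apply/orP; right.
have sinN (z : R) : sin z = sin (pi - z) by rewrite sinB sinpi cospi; ring.
by rewrite (sinN y) (sinN d) ler_sin_pihalf //; lra.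
Qed.

(** As [sin a <= 2 sin (a / 2)], the middle of a gap keeps half of the gap's sine as distance to
    every line. It supplies the direction of a slice mix that stays invertible along the whole
    path. *)
Lemma half_gap_angle (R : realType) (n : nat) (theta : 'I_n -> R)
    (theta_rng : forall r, 0 <= theta r < pi)
    (theta_mono : forall r s : 'I_n, (r <= s)%N -> theta r <= theta s)
    (d : R) (g : 'I_n) (d_gt0 : 0 < d)
    (gap : 2 * d <= `|sin (theta g - theta (ordS g))|) :
  exists phi, forall r, d <= `|sin (theta r - phi)|.
Proof.
have pi0 := pi_gt0 R.
(* The angle [phi] is the centre of an arc of length [a] free of [theta]s. *)
suff [a [phi [a_ge0 a_lepi sin_a far]]] : exists a phi,
    [/\ 0 <= a, a <= pi, 2 * d <= sin a &
        forall r, a / 2 <= `|theta r - phi| <= pi - a / 2].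
  exists phi => r; have /andP[lo hi] := far r.
  have dsin : d <= sin (a / 2).
    have : sin a = 2 * (sin (a / 2) * cos (a / 2)).
      rewrite {1}(splitr a) sinD; ring.
    have := cos_le1 (a / 2).
    have : 0 <= sin (a / 2) by apply: sin_ge0_pi; lra.
    nra.
  have -> : `|sin (theta r - phi)| = `|sin `|theta r - phi| |.
    by case: (ger0P (theta r - phi)); rewrite ?sinN ?normrN.
  apply: le_trans (ler_norm _); apply: le_trans dsin _.
  have := @sin_ge_min R (a / 2) (pi - a / 2) `|theta r - phi|.
  rewrite sinB sinpi cospi mul0r sub0r mulN1r opprK minxx.
  apply; rewrite ?lo ?hi //; lra.
(* The gap after the last index wraps around, lines having period [pi]: the arc runs from
   [theta g - pi] to [theta (ordS g)]. *)
have [gn|gn] := eqVneq g.+1 n.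
  have g0 : ordS g = 0%N :> nat by rewrite /= gn modnn.
  have lo := theta_mono (ordS g) g; rewrite g0 in lo; have {lo} lo := lo (leq0n _).
  have /andP[? ?] := theta_rng g; have /andP[? ?] := theta_rng (ordS g).
  pose a := pi - (theta g - theta (ordS g)).
  exists a, (theta (ordS g) - a / 2); split.
  - by rewrite /a; lra.
  - by rewrite /a; lra.
  - rewrite /a sinB sinpi cospi mul0r sub0r mulN1r opprK.
    by rewrite -[leRHS]ger0_norm // sin_ge0_pi //; apply/andP; split; lra.
  move=> r; have h1 : theta (ordS g) <= theta r by apply: theta_mono; rewrite g0.
  have h2 : theta r <= theta g by apply: theta_mono; rewrite -ltnS gn.
  by rewrite ger0_norm /a; last lra; apply/andP; split; lra.
have gS : ordS g = g.+1 :> nat.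
  by rewrite /= modn_small // ltn_neqAle gn ltn_ord.
have lo : theta g <= theta (ordS g) by apply: theta_mono; rewrite gS.
have /andP[? ?] := theta_rng g; have /andP[? ?] := theta_rng (ordS g).
pose a := theta (ordS g) - theta g.
exists a, (theta g + a / 2); split.
- by rewrite /a; lra.
- by rewrite /a; lra.
- rewrite /a -[leRHS]ger0_norm; last by apply: sin_ge0_pi; apply/andP; split; lra.
  by rewrite -opprB sinN normrN.
move=> r; have /andP[? ?] := theta_rng r.
have [rg|rg] := leqP r g.
  have h : theta r <= theta g by apply: theta_mono.
  by rewrite ler0_norm /a; last lra; apply/andP; split; lra.
have h : theta (ordS g) <= theta r by apply: theta_mono; rewrite gS.
by rewrite ger0_norm /a; last lra; apply/andP; split; lra.
Qed.

(** Large gaps cut the circle of lines into arcs. Two lines in different arcs have a large gap on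
    either side, so the sine of their angle is at least the smaller of the two gap sines. *)
Lemma gap_clusters (R : realType) (n J : nat) (theta : 'I_n -> R)
    (theta_rng : forall r, 0 <= theta r < pi)
    (theta_mono : forall r s : 'I_n, (r <= s)%N -> theta r <= theta s)
    (d : R)
    (gaps : (J < #|[set r : 'I_n |
                     (d <= `|sin (theta r - theta (ordS r))|)%R]%SET|)%N) :
  exists c : 'I_n -> 'I_J.+1, (forall j, exists r, c r = j) /\
    forall r s, c r != c s -> d <= `|sin (theta r - theta s)|.
Proof.
set G := [set r : 'I_n | _]%SET in gaps.
(* [k r] counts the large gaps before [r]. If it is [#|G|], the arc of [r] continues cyclically
   through index [0], hence label [0]; [minn] merges surplus arcs into the last label. *)
pose k (r : 'I_n) := #|[set g in G | (g < r)%N]%SET|.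
pose c (r : 'I_n) : 'I_J.+1 := inord (minn (if k r == #|G| then 0%N else k r) J).
have k_lt (g : 'I_n) : g \in G -> (k g < #|G|)%N.
  move=> gG; apply: proper_card; apply/properP; split.
    by apply/fintype.subsetP => x; rewrite inE => /andP[].
  by exists g => //; rewrite inE ltnn andbF.
have k_inj : {in G &, injective k}.
  have k_ltn (r s : 'I_n) : r \in G -> (r < s)%N -> (k r < k s)%N.
    move=> rG rs; apply: proper_card; apply/properP; split.
      apply/fintype.subsetP => x; rewrite !inE => /andP[-> xr] /=.
      exact: ltn_trans xr rs.
    by exists r; rewrite inE ?rG ?rs // ltnn.
  move=> r s rG sG krs; apply/val_inj; case: (ltngtP r s) => // rs.
    by have := k_ltn _ _ rG rs; rewrite krs ltnn.
  by have := k_ltn _ _ sG rs; rewrite krs ltnn.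
exists c; split => [j|].
  (* On [G] the count is injective with values below [#|G|], so it takes all of them, in particular
     each [j <= J]. *)
  have G_gt0 : (0 < #|G|)%N by apply: leq_ltn_trans gaps.
  have [m GE] : exists m, #|G| = m.+1 by exists #|G|.-1; rewrite prednK.
  pose f (r : 'I_n) : 'I_m.+1 := inord (k r).
  have fE r : r \in G -> f r = k r :> nat by move=> rG; rewrite /f inordK // -GE k_lt.
  have f_inj : {in G &, injective f}.
    move=> r s rG sG /(congr1 val) /=; rewrite !fE //; exact: k_inj.
  have imT : [set f x | x in G]%SET = [set: 'I_m.+1]%SET.
    by apply/eqP; rewrite eqEcard finset.subsetT cardsT card_ord card_in_imset
      // GE leqnn.
  have j_lt : (j < m.+1)%N by rewrite -GE; apply: leq_trans gaps; exact: ltn_ord.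
  have : inord j \in [set f x | x in G]%SET by rewrite imT inE.
  case/imsetP => r rG jE; exists r; apply/val_inj.
  have kr : k r = j by rewrite -fE // -jE inordK.
  rewrite /c kr ltn_eqF; last by rewrite GE.
  by rewrite /= inordK; [apply/minn_idPl; rewrite -ltnS|rewrite ltnS geq_minr].
move=> r s.
wlog rs : r s / (r < s)%N => [hw|crs].
  case: (ltngtP r s) => [rs|sr|/val_inj->]; last by rewrite eqxx.
    exact: hw.
  by rewrite eq_sym => /(hw _ _ sr); rewrite -opprB sinN normrN.
have [g1 [g1G rg1 g1s]] : exists g, [/\ g \in G, (r <= g)%N & (g < s)%N].
  apply: contrapT => none; move/eqP: crs; apply.
  suff -> : c r = c s by [].
  rewrite /c; suff -> : k r = k s by [].
  congr #|pred_of_set _|; apply/setP => g; rewrite !inE.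
  case gG: (d <= _) => //=; apply/idP/idP => [gr|gs]; first exact: ltn_trans gr rs.
  rewrite ltnNge; apply/negP => rg; apply: none; exists g; split => //.
  by rewrite inE.
(* Otherwise [k r = 0] and [k s = #|G|], and both labels are [0]. *)
have [g2 [g2G g2rs]] : exists g, g \in G /\ ((g < r)%N || (s <= g)%N).
  apply: contrapT => none; move/eqP: crs; apply.
  have kr : k r = 0%N.
    apply/eqP; rewrite cards_eq0; apply/eqP/setP => g; rewrite !inE.
    apply/negP => /andP[gG gr]; apply: none; exists g; split; first by rewrite inE.
    by rewrite gr.
  have ks : k s = #|G|.
    congr #|pred_of_set _|; apply/setP => g; rewrite !inE.
    case gG: (d <= _) => //=; rewrite ltnNge; apply/negP => sg.
    apply: none; exists g; split; first by rewrite inE.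
    by rewrite sg orbT.
  by rewrite /c kr ks eqxx; case: eqP.
have pi0 := pi_gt0 R.
have /andP[? ?] := theta_rng r; have /andP[? ?] := theta_rng s.
have normsin (x : R) : 0 <= x <= pi -> `|sin x| = sin x.
  by move=> x_rng; rewrite ger0_norm // sin_ge0_pi.
have gapE (g : 'I_n) : (g.+1 < n)%N -> g \in G ->
    d <= sin (theta (ordS g) - theta g) /\ theta g <= theta (ordS g).
  move=> gn; rewrite inE => gap.
  have gS : ordS g = g.+1 :> nat by rewrite /= modn_small.
  have le : theta g <= theta (ordS g) by apply: theta_mono; rewrite gS.
  have /andP[? ?] := theta_rng g; have /andP[? ?] := theta_rng (ordS g).
  split=> //; rewrite -normsin; last by apply/andP; split; lra.
  by rewrite -opprB sinN normrN.
have g1n : (g1.+1 < n)%N by apply: leq_ltn_trans (ltn_ord s).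
have [gap1 le1] := gapE _ g1n g1G.
have g1S : ordS g1 = g1.+1 :> nat by rewrite /= modn_small.
have le_r : theta r <= theta g1 by exact: theta_mono.
have le_s : theta (ordS g1) <= theta s by apply: theta_mono; rewrite g1S.
(* [b] is the angle of the outer gap [g2], taken modulo [pi] if it is the cyclic one. The angle
   between [r] and [s] then lies between that of [g1] and [pi - b]. *)
have [b [b_ge0 b_le sin_b]] : exists b,
    [/\ 0 <= b, b <= pi - (theta s - theta r) & d <= sin b].
  have [g2n|g2n] := eqVneq g2.+1 n; last first.
    have {}g2n : (g2.+1 < n)%N by rewrite ltn_neqAle g2n ltn_ord.
    have [gap2 le2] := gapE _ g2n g2G.
    have g2S : ordS g2 = g2.+1 :> nat by rewrite /= modn_small.
    exists (theta (ordS g2) - theta g2); split=> //; first by lra.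
    have /andP[? ?] := theta_rng g2; have /andP[? ?] := theta_rng (ordS g2).
    case/orP: g2rs => h.
      have : theta (ordS g2) <= theta r by apply: theta_mono; rewrite g2S.
      lra.
    have : theta s <= theta g2 by apply: theta_mono.
    lra.
  have g0 : ordS g2 = 0%N :> nat by rewrite /= g2n modnn.
  have lo : theta (ordS g2) <= theta r by apply: theta_mono; rewrite g0.
  have hi : theta s <= theta g2 by apply: theta_mono; rewrite -ltnS g2n.
  have /andP[? ?] := theta_rng g2; have /andP[? ?] := theta_rng (ordS g2).
  exists (pi - (theta g2 - theta (ordS g2))); split; try lra.
  rewrite sinB sinpi cospi mul0r sub0r mulN1r opprK.
  move: g2G; rewrite inE normsin //; apply/andP; split; lra.
have sin_min : d <= Num.min (sin (theta (ordS g1) - theta g1)) (sin (pi - b)).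
  by rewrite le_min gap1 sinB sinpi cospi mul0r sub0r mulN1r opprK.
rewrite -opprB sinN normrN; apply: le_trans (ler_norm _).
apply: le_trans sin_min _; apply: sin_ge_min; lra.
Qed.

(** In decreasing order the entries at indices [0] to [J], which are [J + 1] in number, are at least
    the one at [J]. *)
Lemma nth_sort_ge_count (R : realDomainType) (s : seq R) (J : nat) :
  (J < size s)%N -> (J < count (>= nth 0%R (sort >=%R s) J)%R s)%N.
Proof.
move=> J_lt; set t := sort >=%R s.
have st : perm_eq s t by rewrite /t perm_sym perm_sort.
have sz : size t = size s by rewrite size_sort.
have t_sorted : sorted >=%R t by apply: sort_sorted => x y; exact: le_total.
rewrite (seq.permP st) -{2}(cat_take_drop J.+1 t) count_cat.
apply: leq_trans (leq_addr _ _).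
have -> : count (>= nth 0%R t J)%R (take J.+1 t) = size (take J.+1 t).
  apply/eqP; rewrite -all_count; apply/(all_nthP 0) => i.
  rewrite size_take_min leq_min ltnS => /andP[iJ isz]; rewrite nth_take //.
  apply: (sorted_leq_nth _ _ 0 t_sorted) => //; rewrite ?inE ?sz //.
  - by move=> x y z xy yz; exact: le_trans yz xy.
  - exact: lexx.
by rewrite size_takel // sz.
Qed.

(** * Determinants *)

(** The factors are exchanged one at a time, each at a cost of at most [t * b ^+ n]. *)
Lemma norm_prod_sub_le (K : numDomainType) (n : nat) (x y : 'I_n -> K) (b t : K) :
    0 <= b -> 0 <= t -> (forall i, `|x i| <= b) -> (forall i, `|y i| <= b) ->
    (forall i, `|x i - y i| <= t * b) ->
  `|\prod_i x i - \prod_i y i| <= n%:R * t * b ^+ n.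
Proof.
move=> b_ge0 t_ge0; elim: n x y => [|n IHn] x y xb yb xy.
  by rewrite !big_ord0 subrr normr0 !mul0r.
rewrite !big_ord_recl.
set X := \prod_(i < n) _; set Y := \prod_(i < n) _.
have -> : x ord0 * X - y ord0 * Y = (x ord0 - y ord0) * X + y ord0 * (X - Y) by ring.
have -> : n.+1%:R * t * b ^+ n.+1 = (t * b) * b ^+ n + b * (n%:R * t * b ^+ n).
  by rewrite -natr1 exprS; ring.
apply: le_trans (ler_normD _ _) _; rewrite !normrM; apply: lerD.
  apply: ler_pM => //; rewrite /X normr_prod -[n in b ^+ n]card_ord -prodr_const.
  by apply: ler_prod => i _; rewrite normr_ge0 xb.
by apply: ler_pM => //; exact: IHn.
Qed.

(** Leibniz's formula has [n!] terms, each a signed product of [n] entries. *)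
Lemma norm_det_sub_le (K : numDomainType) (n : nat) (M N : 'M[K]_n) (b t : K) :
    0 <= b -> 0 <= t -> (forall i j, `|M i j| <= b) -> (forall i j, `|N i j| <= b) ->
    (forall i j, `|M i j - N i j| <= t * b) ->
  `|\det M - \det N| <= (n`! * n)%:R * t * b ^+ n.
Proof.
move=> b_ge0 t_ge0 Mb Nb MN; rewrite /determinant -sumrB.
apply: le_trans (ler_norm_sum _ _ _) _.
have -> : (n`! * n)%:R * t * b ^+ n = \sum_(s : 'S_n) n%:R * t * b ^+ n.
  by rewrite sumr_const card_Sn -[RHS]mulr_natl natrM; ring.
apply: ler_sum => s _; rewrite -mulrBr normrM normr_sign mul1r.
exact: norm_prod_sub_le.
Qed.

Lemma horner_char_poly (F : comNzRingType) (n : nat) (N : 'M[F]_n) (x : F) :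
  (char_poly N).[x] = \det (x%:M - N).
Proof.
rewrite -horner_evalE -det_map_mx; congr (\det _); apply/matrixP => i j.
by rewrite !mxE /= /horner_eval hornerD hornerN hornerMn hornerX hornerC.
Qed.

(** [M1 + x M0 = M0 (x I - N)] with [N = - M0^-1 M1], so [s] lists the eigenvalues of [N]. *)
Lemma det_addZ_factor (F : closedFieldType) (n : nat) (M0 M1 : 'M[F]_n) :
    \det M0 != 0 ->
  exists2 s : seq F, size s = n &
    forall x, \det (M1 + x *: M0) = \det M0 * \prod_(r <- s) (x - r).
Proof.
move=> M0_neq0.
have M0_unit : M0 \in unitmx by rewrite unitmxE unitfE.
pose N := - (invmx M0 *m M1).
have [s sE] := closed_field_poly_normal (char_poly N).
rewrite (monicP (char_poly_monic N)) scale1r in sE.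
exists s => [|x].
  have := size_char_poly N; rewrite sE size_prod_XsubC; exact: succn_inj.
have -> : \prod_(r <- s) (x - r) = (char_poly N).[x].
  by rewrite sE horner_prod; apply: eq_bigr => r _; rewrite hornerXsubC.
rewrite horner_char_poly -det_mulmx mulmxBr mul_mx_scalar mulmxN mulmxA mulmxV
  // mul1mx opprK.
by rewrite addrC.
Qed.

(** The determinant is a polynomial in [t], so its modulus attains its minimum on [[0, 1]]. A
    uniform [k] allows a uniform step length in the homotopy. *)
Lemma det_affine_lower_bound (R : realType) (n : nat) (U W : 'M[R]_n) :
    (forall t, 0 <= t <= 1 -> \det (U - t *: W) != 0) ->
  exists2 k, 0 < k & forall t, 0 <= t <= 1 -> k <= `|\det (U - t *: W)|.
Proof.
move=> UW; pose p := \det (map_mx polyC U - 'X *: map_mx polyC W).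
have pE t : p.[t] = \det (U - t *: W).
  rewrite -horner_evalE -det_map_mx; congr (\det _); apply/matrixP => i j.
  by rewrite !mxE /= /horner_eval hornerD hornerN hornerM hornerX !hornerC.
have [|c c01 c_min] := @EVT_min R (fun t => `|p.[t]|) 0 1 ler01.
  apply: continuous_subspaceT => t.
  by apply: continuous_comp; [exact: continuous_horner|exact: norm_continuous].
rewrite in_itv /= in c01; exists `|p.[c]|; first by rewrite normr_gt0 pE UW.
by move=> t t01; rewrite -pE; apply: c_min; rewrite in_itv.
Qed.

(** * Complex pencils *)

Lemma det0_ker (F : fieldType) (n : nat) (M : 'M[F]_n) :
  \det M = 0 <-> exists2 z : 'cV[F]_n, z != 0 & M *m z = 0.
Proof.
rewrite -det_tr; split => [/eqP/det0P[v v0 vM]|[z z0 Mz]].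
  exists v^T; first by rewrite trmx_eq0.
  by apply: trmx_inj; rewrite trmx_mul trmxK vM trmx0.
apply/eqP/det0P; exists z^T; first by rewrite trmx_eq0.
by rewrite -trmx_mul Mz trmx0.
Qed.

Section ComplexPencil.
Variables (R : realType) (n : nat).
Local Notation C := R[i].

Lemma slice_mix_complexify (M : tensor R n n 2) (v : 'cV[C]_2) :
  slice_mix (complexify M) v =
    cmx (slice_mix M (remx v)) + 'i%C *: cmx (slice_mix M (immx v)).
Proof.
apply/matrixP => i j; rewrite /slice_mix !big_ord2 !mxE !ffunE !mxE.
by rewrite [v ord0 ord0 in LHS]complexE [v ord_max ord0 in LHS]complexE
  !rmorphD !rmorphM; ring.
Qed.

Lemma slice_mix_complexify_real (M : tensor R n n 2) (v : 'cV[R]_2) :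
  slice_mix (complexify M) (cmx v) = cmx (slice_mix M v).
Proof.
apply/matrixP => i j; rewrite /slice_mix !big_ord2 !mxE !ffunE !mxE.
by rewrite !rmorphD !rmorphM.
Qed.

Lemma slice_mix_complexify_ker (M : tensor R n n 2) (v : 'cV[C]_2) (z : 'cV[C]_n) :
    slice_mix (complexify M) v *m z = 0 ->
  slice_mix M (remx v) *m remx z = slice_mix M (immx v) *m immx z /\
  slice_mix M (remx v) *m immx z = - (slice_mix M (immx v) *m remx z).
Proof.
rewrite slice_mix_complexify.
set U := slice_mix M _; set V := slice_mix M _.
have -> : (cmx U + 'i%C *: cmx V) *m z = cmx (U *m remx z - V *m immx z) +
    'i%C *: cmx (U *m immx z + V *m remx z).
  rewrite {1}[z]cmx_decomp mulmxDl !mulmxDr -!scalemxAr -!scalemxAl scalerA.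
  rewrite -expr2 sqr_i scaleN1r !(map_mxD, map_mxN, map_mxM) scalerDr.
  move: (cmx U *m cmx (remx z)) (cmx V *m cmx (immx z)) => p q.
  move: (cmx U *m cmx (immx z)) (cmx V *m cmx (remx z)) => r t.
  by apply/colP => i; rewrite !mxE; ring.
by move/cmx_eq0 => [/eqP + /eqP]; rewrite subr_eq0 addr_eq0 => /eqP -> /eqP ->.
Qed.

Lemma perpZ (w : C) (z : 'cV[C]_2) : perp (w *: z) = w *: perp z.
Proof. by apply/colP => i; rewrite !mxE; case: ifP => _; rewrite ?mulrN. Qed.

Lemma remx_perp (z : 'cV[C]_2) : remx (perp z) = perp (remx z).
Proof. by apply/colP => i; rewrite !mxE; case: ifP => _; rewrite ?mxE //;
  case: (z _ _). Qed.

Lemma immx_perp (z : 'cV[C]_2) : immx (perp z) = perp (immx z).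
Proof. by apply/colP => i; rewrite !mxE; case: ifP => _; rewrite ?mxE //;
  case: (z _ _). Qed.

(** A phase makes the two parts [a], [b] of [mu] orthogonal. Then [|wedge a b| = |a| |b|], and the
    factor [(|a| + |b|)^2] of the real version is the one in [near]. *)
Lemma bauer_fike (A B : 'M[R]_n) (Cf : 'M[R]_(2, n)) (E : tensor R n n 2) (e : R)
    (mu : 'cV[C]_2) :
    0 <= e -> 0 < sigma_min A * sigma_min B ->
    (forall (v : 'cV[R]_2) (y : 'cV[R]_n),
       dot (slice_mix E v *m y) (slice_mix E v *m y) <= e ^+ 2 * dot v v * dot y y) ->
    \det (slice_mix (complexify (cpd A B Cf - E)) (perp mu)) = 0 ->
  exists r, near (e / (sigma_min A * sigma_min B)) (col r Cf) mu.
Proof.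
move=> e_ge0 s_gt0 E_le /det0_ker[z z0 muz].
have [w w0 w_orth] := orthogonal_phase mu.
have : slice_mix (complexify (cpd A B Cf - E)) (perp (w *: mu)) *m z = 0.
  by rewrite perpZ slice_mixZr -scalemxAl muz scaler0.
move/slice_mix_complexify_ker; rewrite remx_perp immx_perp => -[eqx eqy].
have xy : (remx z != 0) || (immx z != 0).
  rewrite -negb_and; apply: contra z0 => /andP[/eqP re0 /eqP im0].
  by rewrite [z]cmx_decomp re0 im0 !map_mx0 scaler0 addr0.
have [r] := bauer_fike_real e_ge0 E_le xy eqx eqy.
rewrite !dot_perpr !sqrrN => le; exists r; apply: (near_scale w0).
rewrite /near /sqmod; move: le w_orth; move: (remx _) (immx _) => a b.
have enorm_perp (u : 'cV[R]_2) : enorm (perp u) = enorm u.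
  by apply/eqP; rewrite -(@eqrXn2 _ 2) ?enorm_ge0 // !enorm_sqr dot_perp.
rewrite !enorm_perp => le ab.
have -> : `|wedge a b| = enorm a * enorm b.
  apply/eqP; rewrite -(@eqrXn2 _ 2) ?mulr_ge0 ?enorm_ge0 // exprMn !enorm_sqr.
  by rewrite real_normK ?num_real // wedge_sqr ab expr0n subr0.
rewrite expr_div_n mulrAC ler_pdivlMr ?exprn_gt0 // mulrC.
by apply: le_trans le _; rewrite -!enorm_sqr le_eqVlt; apply/orP; left; apply/eqP; ring.
Qed.

(* An affine chart of the projective line, with [perp v0] at infinity. *)
Definition chart (v0 : 'cV[R]_2) (x : C) : 'cV[C]_2 := cmx v0 - x *: cmx (perp v0).

Lemma perp_chart v0 x : perp (chart v0 x) = cmx (perp v0) + x *: cmx v0.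
Proof.
apply/colP => i; rewrite !mxE.
have [->|->] : i = ord0 \/ i = ord_max.
  by case: i => -[|[|//]] h; [left|right]; apply/val_inj.
  by rewrite /= !rmorphN; ring.
by rewrite /= !rmorphN; ring.
Qed.

Lemma wedge_chart v0 x y : dot v0 v0 = 1 -> wedge (chart v0 x) (chart v0 y) = x - y.
Proof.
rewrite dot2E => v1; rewrite /wedge /chart !mxE /= !rmorphN.
have /(congr1 (real_complex R)) := v1; rewrite rmorphD !rmorphM rmorph1 => v1c.
by rewrite -[RHS]mulr1 -v1c; ring.
Qed.

Lemma sqmod_chart v0 x : dot v0 v0 = 1 ->
  sqmod (chart v0 x) = 1 + complex.Re x ^+ 2 + complex.Im x ^+ 2.
Proof.
case: x => a b; rewrite dot2E => v1; rewrite /sqmod !dot2E /chart !mxE /=.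
have -> : 1 + a ^+ 2 + b ^+ 2 = (v0 ord0 ord0 * v0 ord0 ord0 +
  v0 ord_max ord0 * v0 ord_max ord0) * (1 + a ^+ 2 + b ^+ 2) by rewrite v1 mul1r.
ring.
Qed.

Variables (M : tensor C n n 2) (v0 : 'cV[R]_2).
Hypothesis v0_unit : dot v0 v0 = 1.
Hypothesis M_unit : \det (slice_mix M (cmx v0)) != 0.

(** Only the point at infinity is missing from the chart; there [perp mu] is a multiple of [v0],
    whose slice mix is invertible. *)
Lemma chart_root (mu : 'cV[C]_2) : mu != 0 ->
    \det (slice_mix M (perp mu)) = 0 ->
  exists a x, [/\ a != 0, mu = a *: chart v0 x &
                  \det (slice_mix M (perp (chart v0 x))) = 0].
Proof.
move=> mu0 root_mu.
have v1c : (v0 ord0 ord0)%:C%C ^+ 2 + (v0 ord_max ord0)%:C%C ^+ 2 = 1.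
  have /(congr1 (real_complex R)) := v0_unit.
  by rewrite dot2E rmorphD !rmorphM rmorph1 !expr2.
pose a := dot mu (cmx v0); pose b := dot mu (cmx (perp v0)).
have muE : mu = a *: cmx v0 + b *: cmx (perp v0).
  apply/colP => i; rewrite /a /b !dot2E !mxE /=.
  have [->|->] : i = ord0 \/ i = ord_max.
    by case: i => -[|[|//]] h; [left|right]; apply/val_inj.
    by rewrite /= !rmorphN -[LHS]mulr1 -v1c; ring.
  by rewrite /= !rmorphN -[LHS]mulr1 -v1c; ring.
have [a0|a0] := eqVneq a 0.
  have perp_mu : perp mu = (- b) *: cmx v0.
    rewrite muE a0 scale0r add0r perpZ scaleNr -scalerN; congr (_ *: _).
    apply/colP => i; rewrite !mxE.
    have [->|->] : i = ord0 \/ i = ord_max.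
      by case: i => -[|[|//]] h; [left|right]; apply/val_inj.
      by rewrite /=.
    by rewrite /= rmorphN.
  have b0 : b != 0 by apply: contraNneq mu0 => b0; rewrite muE a0 b0 !scale0r addr0.
  move/eqP: root_mu; rewrite perp_mu slice_mixZr detZ mulf_eq0 (negPf M_unit) orbF.
  by rewrite expf_eq0 oppr_eq0 (negPf b0) andbF.
exists a, (- b / a).
have muE' : mu = a *: chart v0 (- b / a).
  rewrite /chart scalerBr scalerA mulrCA divff // mulr1 scaleNr opprK.
  exact: muE.
split; [exact: a0|exact: muE'|]; move/eqP: root_mu;
  rewrite [X in perp X]muE' perpZ slice_mixZr detZ mulf_eq0.
by rewrite expf_eq0 (negPf a0) andbF => /eqP.
Qed.

Lemma chart_factor : exists2 s : seq C, size s = n &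
  forall x, \det (slice_mix M (perp (chart v0 x))) =
    \det (slice_mix M (cmx v0)) * \prod_(r <- s) (x - r).
Proof.
have [s s_size sE] := det_addZ_factor (slice_mix M (cmx (perp v0))) M_unit.
by exists s => // x; rewrite perp_chart slice_mixDr slice_mixZr sE.
Qed.

End ComplexPencil.

(** * Following the eigenvalues from [T] to [Y] *)

Section Homotopy.
Variables (R : realType) (n : nat) (I : eqType).
Variables (T E : tensor R n n 2) (c : 'I_n -> 'cV[R]_2) (lab : 'I_n -> I).
Variables (rho h k : R) (v0 : 'cV[R]_2).
Local Notation C := R[i].

Hypothesis eig_near : forall t, 0 <= t <= 1 -> forall mu : 'cV[C]_2,
  \det (slice_mix (complexify (T - t *: E)) (perp mu)) = 0 ->
  exists r, near rho (c r) mu.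
Hypothesis h_gt0 : 0 < h.
Hypothesis lab_separated : forall r s (mu nu : 'cV[C]_2), lab r != lab s ->
  mu != 0 -> nu != 0 -> near rho (c r) mu -> near rho (c s) nu ->
  h ^+ 2 * (sqmod mu * sqmod nu) <=
    complex.Re (wedge mu nu) ^+ 2 + complex.Im (wedge mu nu) ^+ 2.
Hypothesis v0_unit : dot v0 v0 = 1.
Hypothesis k_gt0 : 0 < k.
Hypothesis v0_regular : forall t, 0 <= t <= 1 ->
  k <= `|\det (slice_mix (T - t *: E) v0)|.

Definition has_eig_near (t : R) (j : I) : Prop := exists mu : 'cV[C]_2,
  [/\ mu != 0, \det (slice_mix (complexify (T - t *: E)) (perp mu)) = 0 &
      exists2 r, lab r = j & near rho (c r) mu].

Lemma slice_mix_complexifyB (M N : tensor R n n 2) (v : 'cV[C]_2) :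
  slice_mix (complexify (M - N)) v =
    slice_mix (complexify M) v - slice_mix (complexify N) v.
Proof.
rewrite -sumrB; apply: eq_bigr => s _; rewrite -scalerBr !ffunE.
by rewrite map_mxD map_mxN.
Qed.

Lemma slice_mix_entry_le (M : tensor R n n 2) (mu : 'cV[C]_2) (b : R) i j :
    (forall i j, \sum_s `|M s i j| <= b) ->
  `|slice_mix (complexify M) (perp mu) i j| <= (Num.sqrt (sqmod mu) * b)%:C%C.
Proof.
move=> Mb; rewrite /slice_mix summxE.
have mu_le (s : 'I_2) : `|perp mu s ord0| <= (Num.sqrt (sqmod mu))%:C%C.
  have sq_le (i0 : 'I_2) : `|mu i0 ord0| <= (Num.sqrt (sqmod mu))%:C%C.
    rewrite normc_def lecR ler_sqrt; last first.
      by rewrite /sqmod addr_ge0 ?dot_ge0.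
    rewrite /sqmod /dot -big_split (bigD1 i0) //= !mxE -!expr2 lerDl.
    by apply: sumr_ge0 => l _; rewrite -!expr2 addr_ge0 ?sqr_ge0.
  by rewrite mxE; case: ifP => _; rewrite ?normrN.
apply: le_trans (ler_norm_sum _ _ _) _.
apply: le_trans (_ : \sum_s (Num.sqrt (sqmod mu))%:C%C * `|M s i j|%:C%C <= _).
  apply: ler_sum => s _; rewrite mxE normrM ler_pM // ffunE mxE.
  by rewrite normc_def /= expr0n addr0 sqrtr_sqr.
by rewrite -big_distrr /= -rmorph_sum -rmorphM lecR ler_wpM2l ?sqrtr_ge0.
Qed.

(** Let [x] be the root at time [t], in the chart, and [m] the norm of its representative. If no
    root at [t'] were near cluster [j], all [n] of them would be at distance at least [h m] from
    [x], and the determinant at [t'] would have modulus at least [k (h m)^n] in [x]. It vanishes at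
    [t], so the change over the step is too small for that. The factor [m^n] cancels, so the step
    length does not depend on [x]. *)
Lemma has_eig_near_step (b t t' : R) (j : I) :
    0 <= b ->
    (forall i j, \sum_s (`|T s i j| + `|E s i j|) <= b) ->
    0 <= t <= 1 -> 0 <= t' <= 1 ->
    (n`! * n)%:R * `|t - t'| * b ^+ n < k * h ^+ n ->
  has_eig_near t j -> has_eig_near t' j.
Proof.
move=> b_ge0 TEb t01 t'01 small [mu [mu0 mu_root [r0 lab_r0 near_mu]]].
set Mt := T - t *: E in mu_root; set Mt' := T - t' *: E.
have regular s : 0 <= s <= 1 ->
    \det (slice_mix (complexify (T - s *: E)) (cmx v0)) != 0.
  move=> s01; rewrite slice_mix_complexify_real det_map_mx fmorph_eq0.
  by rewrite -normr_gt0; apply: lt_le_trans k_gt0 (v0_regular s01).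
have [a [x [a0 muE x_root]]] := chart_root v0_unit (regular t t01) mu0 mu_root.
have [s s_size sE] := chart_factor (regular t' t'01).
have chart_sqmod y : 1 <= sqmod (chart v0 y).
  by rewrite sqmod_chart // -addrA lerDl addr_ge0 ?sqr_ge0.
have chart_neq0 y : chart v0 y != 0.
  by rewrite -sqmod_gt0; apply: lt_le_trans (chart_sqmod y).
have near_x : near rho (c r0) (chart v0 x).
  by apply: (near_scale a0); rewrite -muE.
apply: contrapT => no_eig.
pose m := Num.sqrt (sqmod (chart v0 x)).
have m_gt0 : 0 < m by rewrite sqrtr_gt0 (lt_le_trans ltr01).
(* In the chart [wedge] is [x - y], and the norm of the representative of [y] is at least [1]. *)
have root_far y : y \in s -> (h * m)%:C%C <= `|x - y|.
  move=> ys.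
  have y_root : \det (slice_mix (complexify Mt') (perp (chart v0 y))) = 0.
    by rewrite sE (big_rem y) //= subrr mul0r mulr0.
  have [r1 near_y] := eig_near t'01 y_root.
  have labs : lab r0 != lab r1.
    apply/eqP => labs; apply: no_eig; exists (chart v0 y); split => //.
    by exists r1; rewrite -?labs.
  have := lab_separated labs (chart_neq0 x) (chart_neq0 y) near_x near_y.
  rewrite wedge_chart // normc_def lecR => sep.
  rewrite -(@ler_pXn2r _ 2) ?nnegrE ?sqrtr_ge0 ?mulr_ge0 ?(ltW m_gt0) ?(ltW h_gt0) //.
  rewrite sqr_sqrtr ?addr_ge0 ?sqr_ge0 // exprMn sqr_sqrtr; last first.
    by rewrite (le_trans ler01).
  apply: le_trans sep; rewrite ler_wpM2l ?sqr_ge0 // ler_peMr //.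
  by rewrite (le_trans ler01).
have lower : (k * (h * m) ^+ n)%:C%C <=
    `|\det (slice_mix (complexify Mt') (perp (chart v0 x)))|.
  rewrite sE normrM rmorphM ler_pM //.
  - by rewrite ler0c ltW.
  - by rewrite ler0c exprn_ge0 // mulr_ge0 // ltW.
  - rewrite slice_mix_complexify_real det_map_mx normc_def /= expr0n addr0 sqrtr_sqr.
    by rewrite lecR v0_regular.
  have exprE (w : C) : w ^+ n = \prod_(r <- s) w.
    by rewrite big_const_seq count_predT s_size -Monoid.iteropE.
  rewrite rmorphXn exprE normr_prod.
  rewrite [leLHS]big_seq_cond [leRHS]big_seq_cond.
  apply: ler_prod => y; rewrite andbT => ys; rewrite root_far // andbT ler0c.
  by rewrite mulr_ge0 // ltW.
have sum_le (u : R) i l : 0 <= u <= 1 -> \sum_s0 `|(T - u *: E) s0 i l| <= b.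
  case/andP => u_ge0 u_le1; apply: le_trans (TEb i l); apply: ler_sum => s0 _.
  rewrite !ffunE !mxE; apply: le_trans (ler_normB _ _) _.
  by rewrite lerD2l normrM (ger0_norm u_ge0) ler_piMl.
have upper : `|\det (slice_mix (complexify Mt') (perp (chart v0 x)))| <=
    ((n`! * n)%:R * `|t - t'| * (m * b) ^+ n)%:C%C.
  apply: le_trans (_ : `|\det (slice_mix (complexify Mt') (perp (chart v0 x))) -
    \det (slice_mix (complexify Mt) (perp (chart v0 x)))| <= _).
    by rewrite [X in _ - X]x_root subr0.
  have -> : ((n`! * n)%:R * `|t - t'| * (m * b) ^+ n)%:C%C =
      (n`! * n)%:R * `|t - t'|%:C%C * (m * b)%:C%C ^+ n :> C.
    by rewrite !(rmorphM, rmorphXn, rmorph_nat).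
  apply: norm_det_sub_le; rewrite ?ler0c ?normr_ge0 //.
  - by rewrite mulr_ge0 // ltW.
  - by move=> i l; apply: slice_mix_entry_le => *; exact: sum_le.
  - by move=> i l; apply: slice_mix_entry_le => *; exact: sum_le.
  move=> i l; rewrite -rmorphM mulrCA.
  rewrite (_ : _ - _ = slice_mix (complexify ((t - t') *: E)) (perp (chart v0 x)) i l).
    apply: slice_mix_entry_le => i1 l1.
    under eq_bigr do rewrite ffunE mxE normrM.
    rewrite -big_distrr ler_wpM2l //=; apply: le_trans (TEb i1 l1).
    by apply: ler_sum => s0 _; rewrite lerDr.
  have -> : (t - t') *: E = Mt' - Mt.
    by rewrite scalerBl /Mt' /Mt opprB [RHS]addrC addrA subrK.
  by rewrite slice_mix_complexifyB !mxE.
have := le_trans lower upper; rewrite lecR !exprMn.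
have -> : k * (h ^+ n * m ^+ n) = k * h ^+ n * m ^+ n by ring.
have -> : (n`! * n)%:R * `|t - t'| * (m ^+ n * b ^+ n) =
   (n`! * n)%:R * `|t - t'| * b ^+ n * m ^+ n by ring.
by rewrite ler_pM2r ?exprn_gt0 // leNgt small.
Qed.

Lemma has_eig_near_homotopy (j : I) : has_eig_near 0 j -> has_eig_near 1 j.
Proof.
move=> start.
pose b := \sum_i \sum_l \sum_s (`|T s i l| + `|E s i l|).
have TEb i l : \sum_s (`|T s i l| + `|E s i l|) <= b.
  rewrite /b (bigD1 i) //= (bigD1 l) //= -addrA lerDl addr_ge0 //.
    by do 2!apply: sumr_ge0 => ? _; rewrite ?addr_ge0.
  by do 3!apply: sumr_ge0 => ? _; rewrite ?addr_ge0.
have b_ge0 : 0 <= b by do 3!apply: sumr_ge0 => ? _; rewrite ?addr_ge0.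
(* Steps of length [1 / N] with [N > K] satisfy the smallness condition all along the path. *)
pose K := (n`! * n)%:R * b ^+ n / (k * h ^+ n).
have kh_gt0 : 0 < k * h ^+ n by rewrite mulr_gt0 ?exprn_gt0.
pose N := (Num.truncn K).+1.
have K_lt : K < N%:R by exact: truncnS_gt.
have N_gt0 : 0 < N%:R :> R by rewrite ltr0n.
suff steps i : (i <= N)%N -> has_eig_near (i%:R / N%:R) j.
  by have := steps N (leqnn N); rewrite divff // gt_eqF.
elim: i => [|i IHi] iN; first by rewrite mul0r.
have in01 (l : nat) : (l <= N)%N -> 0 <= (l%:R / N%:R : R) <= 1.
  by move=> lN; rewrite divr_ge0 ?ler0n //= ler_pdivrMr // mul1r ler_nat.
apply: (has_eig_near_step b_ge0 TEb _ _ _ (IHi (ltnW iN))); rewrite ?in01 //;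
  first exact: ltnW.
rewrite -mulrBl -natr1 opprD addrA subrr sub0r mulN1r normrN.
rewrite gtr0_norm ?invr_gt0 // mulrAC ltr_pdivrMr //.
by rewrite [ltRHS]mulrC -ltr_pdivrMr.
Qed.

End Homotopy.

(** * Chordal metric and angles *)

Lemma vlineZ_eq (F : fieldType) (n : nat) (k : F) (x : 'cV[F]_n) : k != 0 ->
  <[k *: x]>%VS = <[x]>%VS.
Proof.
move=> k0; apply/eqP; rewrite eqEsubv -!memvE memvZ ?memv_line //=.
by rewrite -[x in x \in _](scalerK k0) memvZ ?memv_line.
Qed.

Section Chordal.
Variables (R : realType) (F : fieldType) (conj : F -> F) (abs : F -> R) (iota : R -> F).
Hypothesis absM : {morph abs : x y / x * y}.
Hypothesis abs_ge0 : forall x, 0 <= abs x.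
Hypothesis abs_conj : forall x, abs (conj x) = abs x.
Hypothesis conjM : {morph conj : x y / x * y}.
Hypothesis abs_iota : forall r, abs (iota r) = `|r|.

Lemma l2norm_scale n k (x : 'cV[F]_n) : l2norm abs (k *: x) = abs k * l2norm abs x.
Proof.
rewrite /l2norm -[in RHS](ger0_norm (abs_ge0 k)) -sqrtr_sqr -sqrtrM ?sqr_ge0 //.
congr Num.sqrt.
by rewrite big_distrr; apply: eq_bigr => i _; rewrite mxE absM exprMn.
Qed.

(** All unit vectors on the two lines give the same modulus [s] of the inner product, so the
    supremum is over a singleton, and [sin (acos s)] is [sqrt (1 - s^2)]. In the applications [w] is
    the modulus of a [wedge]. *)
Lemma chordal_vline (x y : 'cV[F]_2) (w : R) :
    0 < l2norm abs x -> 0 < l2norm abs y -> 0 <= w ->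
    abs (inner conj x y) ^+ 2 + w ^+ 2 = (l2norm abs x * l2norm abs y) ^+ 2 ->
  chordal conj abs <[x]> <[y]> = w / (l2norm abs x * l2norm abs y).
Proof.
move=> x_gt0 y_gt0 w_ge0 xyw.
have xy_gt0 : 0 < l2norm abs x * l2norm abs y by rewrite mulr_gt0.
pose s := abs (inner conj x y) / (l2norm abs x * l2norm abs y).
have innerZ a b : inner conj (a *: x) (b *: y) = a * conj b * inner conj x y.
  rewrite /inner big_distrr; apply: eq_bigr => i _ /=.
  by rewrite !mxE conjM mulrACA.
rewrite /chordal /principal_angle (_ : [set t | _] = [set s]); last first.
  apply/seteqP; split => [t [u [v [/vlineP[a ->] /vlineP[b ->]]]]|t ->] /=.
    rewrite !l2norm_scale => a1 b1 ->; rewrite innerZ !absM abs_conj /s.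
    apply: (@mulIf _ (l2norm abs x * l2norm abs y)); first by rewrite gt_eqF.
    by rewrite divfK ?gt_eqF // mulrC mulrA mulrACA [_ * abs a]mulrC [_ * abs
      b]mulrC a1 b1 !mul1r.
  exists (iota (l2norm abs x)^-1 *: x), (iota (l2norm abs y)^-1 *: y).
  rewrite !memvZ ?memv_line // !l2norm_scale innerZ !absM abs_conj !abs_iota.
  rewrite !gtr0_norm ?invr_gt0 // !mulVf ?gt_eqF //; split => //.
  by rewrite /s invfM mulrC.
have s01 : 0 <= s <= 1.
  rewrite divr_ge0 ?(ltW xy_gt0) //= ler_pdivrMr // mul1r.
  by rewrite -(@ler_pXn2r _ 2) ?nnegrE ?(ltW xy_gt0) // -xyw lerDl sqr_ge0.
case/andP: s01 => s_ge0 s_le1.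
rewrite sup1 sin_acos; last by rewrite s_le1 (le_trans _ s_ge0) // lerN10.
have -> : 1 - s ^+ 2 = (w / (l2norm abs x * l2norm abs y)) ^+ 2.
  rewrite /s !expr_div_n -xyw.
  have : abs (inner conj x y) ^+ 2 + w ^+ 2 != 0 by rewrite xyw expf_neq0 ?gt_eqF.
  by move=> nz; field.
by rewrite sqrtr_sqr ger0_norm // divr_ge0 // ltW.
Qed.

End Chordal.

Section ChordalLines.
Variable R : realType.
Local Notation C := R[i].

Definition unit_dir (t : R) : 'cV[R]_2 := \col_(i < 2) (if i == ord0 then cos t
  else sin t).

Lemma unit_dir_dot t : dot (unit_dir t) (unit_dir t) = 1.
Proof. by rewrite dot2E !mxE /= -!expr2 cos2Dsin2. Qed.

Lemma wedge_unit_dir s t : wedge (unit_dir s) (unit_dir t) = sin (t - s).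
Proof. by rewrite /wedge !mxE /= sinB; ring. Qed.

Lemma chordalR_unit_dir s t :
  chordalR <[unit_dir s]> <[unit_dir t]> = `|sin (s - t)|.
Proof.
have l1 u : l2norm Num.norm (unit_dir u) = 1.
  by apply/eqP; rewrite -[l2norm _ _]/(enorm (unit_dir u)) enorm_eq1 unit_dir_dot.
rewrite /chordalR (@chordal_vline R R id Num.norm id _ _ _ _ _ _ _ `|sin (s - t)|);
  rewrite ?l1 ?ltr01 ?mulr1 ?divr1 //.
- exact: normrM.
rewrite expr1n !real_normK ?num_real // -[s - t]opprB sinN sqrrN -wedge_unit_dir.
rewrite wedge_sqr !unit_dir_dot mulr1 -[inner _ _ _]/(dot _ _).
by rewrite addrC subrK.
Qed.

Lemma sqmod_normc (n : nat) (z : 'cV[C]_n) :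
  l2norm (@ComplexField.Normc.normc R) z ^+ 2 = sqmod z.
Proof.
rewrite /l2norm sqr_sqrtr; last by apply: sumr_ge0 => i _; exact: sqr_ge0.
rewrite /sqmod /dot -big_split; apply: eq_bigr => i _; rewrite !mxE.
by case: (z i ord0) => a b /=; rewrite sqr_sqrtr ?addr_ge0 ?sqr_ge0 // !expr2.
Qed.

(** By the complex Lagrange identity, the chordal distance is the modulus of [wedge y z] over the
    product of the norms. *)
Lemma chordalC_ge (y z : 'cV[C]_2) (h : R) : y != 0 -> z != 0 -> 0 <= h ->
    h ^+ 2 * (sqmod y * sqmod z) <=
      complex.Re (wedge y z) ^+ 2 + complex.Im (wedge y z) ^+ 2 ->
  h <= chordalC <[y]> <[z]>.
Proof.
move=> y0 z0 h_ge0 le.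
pose nc := @ComplexField.Normc.normc R.
have nc_ge0 x : 0 <= nc x by case: x => a b; exact: sqrtr_ge0.
have ncE x : nc x ^+ 2 = complex.Re x ^+ 2 + complex.Im x ^+ 2.
  by case: x => a b; rewrite /nc /= sqr_sqrtr ?addr_ge0 ?sqr_ge0.
have l2_gt0 (x : 'cV[C]_2) : x != 0 -> 0 < l2norm nc x.
  rewrite -sqmod_gt0 -sqmod_normc -/nc => h0; rewrite lt_neqAle sqrtr_ge0 andbT.
  by rewrite eq_sym; apply: contraTneq h0 => ->; rewrite expr0n ltxx.
have [y_gt0 z_gt0] := (l2_gt0 y y0, l2_gt0 z z0).
have yz_gt0 : 0 < l2norm nc y * l2norm nc z by rewrite mulr_gt0.
rewrite /chordalC -/nc (@chordal_vline R C conjc nc (real_complex R) _ _ _ _ _ _ _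
  (nc (wedge y z))) //.
- rewrite ler_pdivlMr // -(@ler_pXn2r _ 2) ?nnegrE ?mulr_ge0 ?(ltW y_gt0) ?(ltW
  z_gt0) //.
  by rewrite exprMn [(l2norm _ _ * _) ^+ 2]exprMn !sqmod_normc ncE.
- by move=> u v; exact: ComplexField.Normc.normcM.
- by move=> [a b]; rewrite /nc /= sqrrN.
- by move=> u v; rewrite rmorphM.
- by move=> r; rewrite /nc /= expr0n addr0 sqrtr_sqr.
rewrite exprMn !sqmod_normc !ncE /inner big_ord2 /sqmod !dot2E /wedge !mxE.
case: (y _ _) => a0 b0; case: (y _ _) => a1 b1.
case: (z _ _) => a2 b2; case: (z _ _) => a3 b3 /=.
ring.
Qed.

(** [theta] is defined by choice, so an angle has to be exhibited: [0] if the second coordinate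
    vanishes, otherwise an [acos] after making that coordinate positive. *)
Lemma theta_spec (x : 'cV[R]_2) : x != 0 ->
  0 <= theta x < pi /\ <[x]>%VS = <[unit_dir (theta x)]>%VS.
Proof.
move=> x0.
suff [t tP] : exists t, 0 <= t < pi /\ <[x]>%VS = <[unit_dir t]>%VS.
  exact: (@getPex _ [set t | 0 <= t < pi /\ <[x]>%VS = <[unit_dir t]>%VS]
    (ex_intro _ t tP)).
have pi0 := pi_gt0 R.
suff [t [r [t_rng r0 xE]]] : exists t r, [/\ 0 <= t < pi, r != 0 & x = r *: unit_dir t].
  by exists t; rewrite xE vlineZ_eq.
have [y0|y0] := eqVneq (x ord_max ord0) 0.
  exists 0, (x ord0 ord0).
  have xE : x = x ord0 ord0 *: unit_dir 0.
    apply/colP => i; rewrite !mxE cos0 sin0.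
    case: ifP => [/eqP->|i1]; first by rewrite mulr1.
    by rewrite mulr0 -y0; congr (x _ _); case: i i1 => -[|[|//]] // h _; apply/val_inj.
  split=> //; first by rewrite lexx pi0.
  by apply: contraNneq x0 => r0; rewrite xE r0 scale0r.
wlog y_gt0 : x x0 y0 / 0 < x ord_max ord0.
  move=> pos_case; have [y_gt0|y_le0] := ltP 0 (x ord_max ord0); first exact: pos_case.
  have [|||t [r [t_rng r0 xE]]] := pos_case (- x).
  - by rewrite oppr_eq0.
  - by rewrite mxE oppr_eq0.
  - by rewrite mxE oppr_gt0 lt_neqAle y0.
  by exists t, (- r); rewrite oppr_eq0 scaleNr -xE opprK.
pose r := enorm x; have rE : r ^+ 2 = x ord0 ord0 ^+ 2 + x ord_max ord0 ^+ 2.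
  by rewrite enorm_sqr dot2E !expr2.
have r_gt0 : 0 < r.
  rewrite lt_neqAle enorm_ge0 andbT eq_sym -sqrf_eq0 rE gt_eqF //.
  by rewrite ltr_wpDl ?sqr_ge0 // exprn_gt0.
have r0 : r != 0 by rewrite gt_eqF.
pose c := x ord0 ord0 / r.
have cE : 1 - c ^+ 2 = (x ord_max ord0 / r) ^+ 2.
  rewrite /c !expr_div_n; have := rE => /eqP; rewrite addrC -subr_eq => /eqP <-.
  by field.
have c2 : c ^+ 2 < 1.
  by rewrite -subr_gt0 cE exprn_gt0 // divr_gt0.
have /andP[c_gtN1 c_lt1] : -1 < c < 1.
  by rewrite -ltr_norml -(@expr_lt1 _ 2) // real_normK ?num_real.
exists (acos c), r; split=> //.
  by rewrite acos_ge0 ?acos_ltpi // ?c_gtN1 ?ltW.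
apply/colP => i; rewrite !mxE acosK; last by rewrite in_itv /= !ltW.
rewrite sin_acos; last by rewrite !ltW.
case: ifP => [/eqP->|i1]; first by rewrite /c mulrC divfK.
rewrite cE sqrtr_sqr gtr0_norm ?divr_gt0 // mulrC divfK //.
by congr (x _ _); case: i i1 => -[|[|//]] // h _; apply/val_inj.
Qed.

End ChordalLines.

(** * Generalized eigenvalues *)

(** An invertible mix forces [q] to be nonzero, since otherwise [z] would be killed by both slices.
    The vector [q] is found by dividing by a nonzero coordinate of [mu]. *)
Lemma geneigsP (F : fieldType) (n : nat) (M : tensor F n n 2) (v : 'cV[F]_2)
    (U : {vspace 'cV[F]_2}) : \det (slice_mix M v) != 0 ->
  geneigs M U <->
    exists mu, [/\ mu != 0, U = <[mu]>%VS & \det (slice_mix M (perp mu)) = 0].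
Proof.
move=> v_unit; split=> [[mu [z [q [mu0 -> z0 q0 Mz]]]]|[mu [mu0 -> /det0_ker[z
  z0 Mz]]]].
  exists mu; split=> //; apply/det0_ker; exists z => //.
  rewrite /slice_mix big_ord2 mulmxDl -!scalemxAl !Mz !scalerA perp0E perp1E.
  by rewrite mulrC mulrN scaleNr addNr.
have Mz0 (q : 'cV[F]_n) : (forall k : 'I_2, M k *m z = mu k ord0 *: q) -> q != 0.
  move=> Mq; apply: contraNneq v_unit => q0; apply/eqP/det0_ker; exists z => //.
  by rewrite /slice_mix big_ord2 mulmxDl -!scalemxAl !Mq q0 !scaler0 addr0.
have Mperp : mu ord0 ord0 *: (M ord_max *m z) = mu ord_max ord0 *: (M ord0 *m z).
  move/eqP: Mz; rewrite /slice_mix big_ord2 mulmxDl -!scalemxAl perp0E perp1E.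
  by rewrite scaleNr addrC subr_eq0 => /eqP.
have split2 (k : 'I_2) : k = ord0 \/ k = ord_max.
  by case: k => -[|[|//]] h; [left|right]; apply/val_inj.
have [q Mq] : exists q, forall k : 'I_2, M k *m z = mu k ord0 *: q.
  have [m0|m0] := eqVneq (mu ord0 ord0) 0.
    have m1 : mu ord_max ord0 != 0.
      apply: contraNneq mu0 => m1; apply/eqP/colP => i; rewrite mxE.
      by have [->|->] := split2 i.
    exists ((mu ord_max ord0)^-1 *: (M ord_max *m z)) => k.
    have [->|->] := split2 k; last by rewrite scalerKV.
    apply: (scalerI m1); rewrite -Mperp m0 !scale0r scaler0 //.
  exists ((mu ord0 ord0)^-1 *: (M ord0 *m z)) => k.
  have [->|->] := split2 k; first by rewrite scalerKV.
  by apply: (scalerI m0); rewrite Mperp !scalerA mulrAC divff // mul1r.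
by exists mu, z, q; split=> //; exact: Mz0 Mq.
Qed.

(** Every eigenvalue is the image under the chart of one of finitely many roots. *)
Lemma finite_geneigs (R : realType) (n : nat) (M : tensor R[i] n n 2) (v : 'cV[R]_2) :
  dot v v = 1 -> \det (slice_mix M (cmx v)) != 0 -> finite_set (geneigs M).
Proof.
move=> v1 M_unit; have [s _ sE] := chart_factor M_unit.
apply: (@sub_finite_set _ _ ((fun x => <[chart v x]>%VS) @` [set` s])); last first.
  exact/finite_image/finite_seq.
move=> U /(geneigsP _ M_unit)[mu [mu0 -> /(chart_root v1 M_unit mu0)]].
move=> [a [x [a0 muE x_root]]]; exists x => /=; last by rewrite muE vlineZ_eq.
move/eqP: x_root; rewrite sE mulf_eq0 (negPf M_unit) prodf_seq_eq0 => /hasP[r rs].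
by rewrite subr_eq0 => /eqP ->.
Qed.

Lemma unit_vline_eq (R : realType) (n : nat) (x y : 'cV[R]_n) :
  dot x x = 1 -> dot y y = 1 -> <[x]>%VS = <[y]>%VS ->
  exists2 k, k ^+ 2 = 1 & x = k *: y.
Proof.
move=> x1 y1 xy; have : x \in <[y]>%VS by rewrite -xy memv_line.
case/vlineP => k xE; exists k => //.
by move: x1; rewrite xE dotZl dotZr y1 mulr1 expr2.
Qed.

(** One representative is chosen in each part; disjointness makes the choice injective. *)
Lemma card_le_partition (T : choiceType) (J : nat) (L : 'I_J -> set T) (A : set T) :
  partition setT L A -> (`I_J #<= A)%card.
Proof.
case=> <- /trivIsetP trivL L0.
have /choice[f fL] : forall j, exists x, L j x.
  by move=> j; have [x Lx] := L0 j Logic.I; exists x.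
have [J0|J_gt0] := posnP J; 
  first by have -> : `I_J = set0; [rewrite J0 II0|exact: card_ge0].
pose g (i : nat) := f (insubd (Ordinal J_gt0) i).
have gL i : L (insubd (Ordinal J_gt0) i) (g i) by exact: fL.
have g_inj : {in `I_J &, injective g}.
  move=> i k; rewrite !inE /= => iJ kJ gik; apply: contrapT => /eqP ik.
  have neq : insubd (Ordinal J_gt0) i != insubd (Ordinal J_gt0) k.
    by apply: contra ik => /eqP/(congr1 val); rewrite !val_insubd iJ kJ => ->.
  have /seteqP[/(_ (g i)) + _] := trivL _ _ Logic.I Logic.I neq.
  by apply; split; [exact: gL|rewrite gik; exact: gL].
rewrite -(card_le_eql (inj_card_eq g_inj)); apply: subset_card_le => _ [i _ <-].
by exists (insubd (Ordinal J_gt0) i).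
Qed.

(** * Clusters of generalized eigenvalues of the perturbed pencil *)

Theorem theorem3p1 (R : realType) (n J : nat) (T Y : tensor R n n 2)
    (A B : 'M[R]_n) (C : 'M[R]_(2, n)) (lam : 'I_n -> 'cV[R]_2)
    (T_smi : slice_mix_invertible T)
    (T_rank : has_rank T n)
    (T_cpd : T = cpd A B C)
    (C_unit : forall r : 'I_n, enorm (col r C) = 1)
    (lam_neq0 : forall r : 'I_n, lam r != 0)
    (lam_eigs : lists_col_spans lam C)
    (lam_sorted : forall r s : 'I_n, s = r.+1 :> nat ->
       [/\ 0 <= theta (lam r), theta (lam r) <= theta (lam s) &
           theta (lam s) < pi])
    (J_gt0 : (0 < J)%N)
    (J_distinct : (`I_J #<= range (fun r : 'I_n => <[lam r]>%VS))%card) :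
  let delta := Jth_half_gap lam J in
  let eps1 := sigma_min A * sigma_min B * delta in
  let eps2 := dist_not_smi T in
  let eps := spnorm (T - Y) in
  eps < Num.min eps1 eps2 ->
  (`I_J #<= geneigs (complexify Y))%card /\
  exists L : 'I_J -> set {vspace 'cV[R[i]]_2},
    [/\ partition setT L (geneigs (complexify Y)),
        forall j, finite_set (L j),
        forall j l, j != l ->
          2 * delta - 2 * eps / (sigma_min A * sigma_min B)
            <= chordalC_set (L j) (L l) &
        0 < 2 * delta - 2 * eps / (sigma_min A * sigma_min B)].
Proof.
move=> delta eps1 eps2 eps; rewrite lt_min => /andP[eps_lt _].
have eps_ge0 : 0 <= eps by exact: spnorm_ge0.
have eps1_gt0 : 0 < eps1 by apply: le_lt_trans eps_lt.
set s := sigma_min A * sigma_min B in eps1 eps_lt eps1_gt0 *.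
have s_ge0 : 0 <= s by rewrite mulr_ge0 ?sigma_min_ge0.
have s_gt0 : 0 < s.
  rewrite lt_neqAle s_ge0 andbT eq_sym; apply: contraTneq eps1_gt0 => s0.
  by rewrite /eps1 s0 mul0r ltxx.
have delta_gt0 : 0 < delta by rewrite -(pmulr_rgt0 _ s_gt0).
pose rho := eps / s.
have rho_ge0 : 0 <= rho by rewrite divr_ge0.
have rho_lt : rho < delta by rewrite ltr_pdivrMr // mulrC.
have bound_gt0 : 0 < 2 * delta - 2 * eps / s.
  by rewrite -mulrA -mulrBr mulr_gt0 // subr_gt0.
pose e r := unit_dir (theta (lam r)).
have theta_rng r : 0 <= theta (lam r) < pi by have [] := theta_spec (lam_neq0 r).
have lamE r : <[lam r]>%VS = <[e r]>%VS by have [] := theta_spec (lam_neq0 r).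
have theta_mono (r r' : 'I_n) : (r <= r')%N -> theta (lam r) <= theta (lam r').
  case: r' => m m_lt /=; elim: m m_lt => [|m IHm] m_lt.
    by rewrite leqn0 => /eqP r0; rewrite (_ : r = Ordinal m_lt) //; apply/val_inj.
  rewrite leq_eqVlt => /predU1P[rE|];
    first by rewrite (_ : r = Ordinal m_lt) //; apply/val_inj.
  rewrite ltnS => rm; apply: le_trans (IHm (ltnW m_lt) rm) _.
  by have [] := lam_sorted (Ordinal (ltnW m_lt)) (Ordinal m_lt) erefl.
have gapE r : chordalR <[lam r]> <[lam (ordS r)]> =
    `|sin (theta (lam r) - theta (lam (ordS r)))|.
  by rewrite !lamE chordalR_unit_dir.
set gaps := [seq chordalR <[lam r]>%VS <[lam (ordS r)]>%VS / 2 | r : 'I_n].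
have deltaE : delta = nth 0 (sort >=%R gaps) J.-1 by [].
(* Past the end of the list [nth] would return [0], but [delta] is positive. *)
have J_le : (J.-1 < size gaps)%N.
  rewrite ltnNge; apply/negP => J_ge; move: delta_gt0.
  by rewrite deltaE nth_default ?ltxx // size_sort.
have many_gaps : (J.-1 < #|[set r : 'I_n |
    (2 * delta <= `|sin (theta (lam r) - theta (lam (ordS r)))|)%R]%SET|)%N.
  apply: leq_trans (nth_sort_ge_count J_le) _.
  rewrite -deltaE /gaps count_map cardsE cardE -size_filter /enum_mem.
  rewrite -filter_predI; apply/eq_leq/congr1/eq_filter => r /=.
  by rewrite gapE ler_pdivlMr // mulrC andbT.
have [lab [lab_surj lab_far]] := gap_clusters theta_rng theta_mono many_gaps.
have [phi phi_far] : exists phi, forall r, delta <= `|sin (theta (lam r) - phi)|.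
  have /card_gt0P[g] := leq_ltn_trans (leq0n _) many_gaps.
  by rewrite inE => /(half_gap_angle theta_rng theta_mono delta_gt0).
have C1 r : dot (col r C) (col r C) = 1.
  by apply/eqP; rewrite -enorm_eq1 C_unit.
have [p pE] := lam_eigs.
(* Up to order and sign, the columns of [C] are the unit vectors [e r]. *)
have colE r : exists2 k, k ^+ 2 = 1 & col (p r) C = k *: e r.
  apply: unit_vline_eq; rewrite ?C1 ?unit_dir_dot //.
  by rewrite -pE lamE.
have k_norm (k : R) : k ^+ 2 = 1 -> `|k| = 1.
  by move=> k1; apply/eqP; rewrite -sqrp_eq1 // real_normK ?num_real // k1.
have col_far q q' : lab (p^-1 q)%g != lab (p^-1 q')%g ->
    2 * delta <= `|wedge (col q C) (col q' C)|.
  move=> /lab_far; rewrite -[in `|wedge _ _|](permKV p q) -[in `|wedge _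
    _|](permKV p q').
  have [k /k_norm k1 ->] := colE (p^-1 q)%g;
    have [k' /k_norm k'1 ->] := colE (p^-1 q')%g.
  have -> : wedge (k *: e (p^-1 q)%g) (k' *: e (p^-1 q')%g) =
      k * (k' * wedge (e (p^-1 q)%g) (e (p^-1 q')%g)).
    by rewrite /wedge !mxE; ring.
  by rewrite !normrM k1 k'1 !mul1r wedge_unit_dir -opprB sinN normrN.
(* Up to sign, [dot c v0] is the [wedge] of [c] with the direction [phi], which is far from all
   columns. *)
pose v0 := perp (unit_dir phi).
have v0_unit : dot v0 v0 = 1 by rewrite dot_perp unit_dir_dot.
have v0_far q : delta <= `|dot (col q C) v0|.
  rewrite /v0 dot_perpr normrN -(permKV p q).
  have [k /k_norm k1 ->] := colE (p^-1 q)%g.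
  have -> : wedge (k *: e (p^-1 q)%g) (unit_dir phi) =
      k * wedge (e (p^-1 q)%g) (unit_dir phi) by rewrite /wedge !mxE; ring.
  by rewrite normrM k1 mul1r wedge_unit_dir -opprB sinN normrN.
pose E := T - Y.
have E_le t (v : 'cV[R]_2) (y : 'cV[R]_n) : 0 <= t <= 1 ->
    dot (slice_mix (t *: E) v *m y) (slice_mix (t *: E) v *m y) <=
      eps ^+ 2 * dot v v * dot y y.
  case/andP=> t_ge0 t_le1; apply: le_trans (slice_mix_spnorm E y v).
  rewrite slice_mixZl -scalemxAl dotZl dotZr mulrA -expr2 ler_piMl ?dot_ge0 //.
  by rewrite expr_le1.
have eig_near t : 0 <= t <= 1 -> forall mu : 'cV[R[i]]_2,
    \det (slice_mix (complexify (T - t *: E)) (perp mu)) = 0 ->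
    exists r, near rho (col r C) mu.
  move=> t01 mu; rewrite T_cpd; apply: bauer_fike => // v y; exact: E_le.
have regular t : 0 <= t <= 1 -> \det (slice_mix (T - t *: E) v0) != 0.
  move=> t01; apply/eqP => /det0_ker[z z0 Mz].
  (* With vanishing imaginary parts, Bauer-Fike gives a column with [s |dot c v0| <= eps < s delta],
     against [v0_far]. *)
  have [||||r] := @bauer_fike_real R n A B C (t *: E) eps eps_ge0 _ v0 0 z 0.
  - by move=> v y; exact: E_le.
  - by rewrite z0.
  - by rewrite -T_cpd Mz mulmx0.
  - by rewrite -[in RHS](scale0r v0) slice_mixZr scale0r mul0mx oppr0 mulmx0.
  have -> : dot (col r C) (0 : 'cV[R]_2) = 0 by rewrite /dot big1 // => l _;
    rewrite !mxE mulr0.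
  have -> : enorm (0 : 'cV[R]_2) = 0.
    by apply/eqP; rewrite -sqrf_eq0 enorm_sqr dot_eq0.
  have /eqP -> : enorm v0 == 1 by rewrite enorm_eq1 v0_unit.
  rewrite expr0n !addr0 expr1n mulr1 -exprMn -/s => le.
  have : (s * dot (col r C) v0) ^+ 2 < (s * delta) ^+ 2.
    by apply: le_lt_trans le _; rewrite ltr_pXn2r ?nnegrE // ltW.
  rewrite (exprMn _ s) (exprMn _ s) ltr_pM2l ?exprn_gt0 // -[ltLHS]real_normK
    ?num_real //.
  by rewrite ltr_pXn2r ?nnegrE ?(ltW delta_gt0) // ltNge v0_far.
have [k k_gt0 k_le] : exists2 k, 0 < k & forall t, 0 <= t <= 1 ->
    k <= `|\det (slice_mix (T - t *: E) v0)|.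
  have [t t01|k k_gt0 k_le] := @det_affine_lower_bound R n (slice_mix T v0)
    (slice_mix E v0).
    by rewrite -slice_mixZl -slice_mixBl; exact: regular.
  by exists k => // t /k_le; rewrite -slice_mixZl -slice_mixBl.
have TE1 : T - 1 *: E = Y by rewrite scale1r /E opprB addrC subrK.
have Y_unit : \det (slice_mix (complexify Y) (cmx v0)) != 0.
  rewrite slice_mix_complexify_real det_map_mx fmorph_eq0 -TE1.
  by apply: regular; rewrite ler01 lexx.
pose h := 2 * delta - 2 * eps / s.
have hE : h = 2 * delta - 2 * rho by rewrite /h /rho mulrA.
have separated r r' (mu nu : 'cV[R[i]]_2) : lab (p^-1 r)%g != lab (p^-1 r')%g ->
    mu != 0 -> nu != 0 -> near rho (col r C) mu -> near rho (col r' C) nu ->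
    h ^+ 2 * (sqmod mu * sqmod nu) <=
      complex.Re (wedge mu nu) ^+ 2 + complex.Im (wedge mu nu) ^+ 2.
  move=> /col_far far mu0 nu0 near_mu near_nu.
  have rho_lt2 : 2 * rho < `|wedge (col r C) (col r' C)|.
    by apply: lt_le_trans far; rewrite ltr_pM2l.
  apply: le_trans (near_separated (C1 r) (C1 r') rho_ge0 rho_lt2 mu0 nu0
    near_mu near_nu).
  rewrite ler_wpM2r ?mulr_ge0 ?addr_ge0 ?dot_ge0 //.
  rewrite ler_pXn2r ?nnegrE ?(ltW bound_gt0) //; first by rewrite hE lerB.
  by rewrite subr_ge0 ltW.
pose L0 (j : 'I_(J.-1).+1) : set {vspace 'cV[R[i]]_2} := [set U | exists mu,
  [/\ mu != 0, U = <[mu]>%VS, \det (slice_mix (complexify Y) (perp mu)) = 0 &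
      exists2 r, lab (p^-1 r)%g = j & near rho (col r C) mu]].
pose L (j : 'I_J) := L0 (cast_ord (esym (prednK J_gt0)) j).
have L0_far (j l : 'I_(J.-1).+1) U V : j != l -> L0 j U -> L0 l V -> h <= chordalC U V.
  move=> jl [mu [mu0 -> _ [r labr near_mu]]] [nu [nu0 -> _ [r' labr' near_nu]]].
  apply: chordalC_ge => //; first exact: ltW.
  by apply: separated near_mu near_nu => //; rewrite labr labr'.
have L0_neq0 j : L0 j !=set0.
  have [r0 labr0] := lab_surj j.
  (* At time [0] the column itself is an eigenvalue, because the diagonal factor of the CPD then has
     a zero entry. *)
  have start : has_eig_near T E (fun r => col r C) (fun r => lab (p^-1 r)%g) rho 0 j.
    exists (cmx (col (p r0) C)); split.
    - rewrite map_mx_eq0; apply: contraTneq (oner_neq0 R) => c0.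
      by rewrite -(C1 (p r0)) dot_eq0 c0 negbK.
    - rewrite scale0r subr0.
      have -> : perp (cmx (col (p r0) C)) = cmx (perp (col (p r0) C)).
        by apply/colP => i; rewrite !mxE; case: ifP => _; rewrite ?rmorphN.
      rewrite slice_mix_complexify_real det_map_mx T_cpd slice_mix_cpd
        !det_mulmx det_diag.
      rewrite (bigD1 (p r0)) //= mxE dot_perpr.
      have -> : wedge (col (p r0) C) (col (p r0) C) = 0 by rewrite /wedge mulrC subrr.
      by rewrite oppr0 mul0r mulr0 mul0r rmorph0.
    - exists (p r0); first by rewrite permK.
      rewrite /near /sqmod.
      have -> : remx (cmx (col (p r0) C)) = col (p r0) C.
        by apply/colP => i; rewrite !mxE.
      have -> : immx (cmx (col (p r0) C)) = 0 by apply/colP => i; rewrite !mxE.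
      rewrite (_ : wedge _ (col _ _) = 0); last by rewrite /wedge mulrC subrr.
      rewrite (_ : wedge _ 0 = 0); last by rewrite /wedge !mxE !mulr0 subrr.
      by rewrite expr0n addr0 mulr_ge0 ?sqr_ge0 // addr_ge0 ?mulr_ge0 ?addr_ge0
        ?dot_ge0.
  have [mu [mu0 mu_root near_mu]] := has_eig_near_homotopy eig_near bound_gt0 separated
    v0_unit k_gt0 k_le start.
  by exists <[mu]>%VS, mu; move: mu_root; rewrite TE1.
have castI (j l : 'I_J) : j != l ->
    cast_ord (esym (prednK J_gt0)) j != cast_ord (esym (prednK J_gt0)) l.
  by apply: contra => /eqP/cast_ord_inj ->.
have L_part : partition setT L (geneigs (complexify Y)).
  split=> [||j _]; last exact: L0_neq0.
  - apply/seteqP; split=> [U [j _ [mu [mu0 -> mu_root _]]]|U].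
      by apply/(geneigsP _ Y_unit); exists mu.
    move=> /(geneigsP _ Y_unit)[mu [mu0 -> mu_root]].
    (* Covering is the Bauer-Fike bound at the end of the path. *)
    have [||r near_mu] := eig_near 1 _ mu; [by rewrite ler01 lexx|by rewrite TE1|].
    exists (cast_ord (prednK J_gt0) (lab (p^-1 r)%g)) => //.
    by exists mu; split=> //; exists r => //; apply/val_inj.
  (* A line in two clusters would have a vanishing [wedge] with itself, against the separation. *)
  apply/trivIsetP => j l _ _ /castI jl; apply/seteqP; split=> // U [].
  move=> [mu [mu0 -> _ [r labr near_mu]]] [nu [nu0 munu _ [r' labr' near_nu]]].
  have /vlineP[k' muE] : mu \in <[nu]>%VS by rewrite -munu memv_line.
  have := @separated r r' mu nu; rewrite labr labr' => /(_ jl mu0 nu0 near_mu near_nu).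
  have -> : wedge mu nu = 0 by rewrite muE /wedge !mxE; ring.
  rewrite /= expr0n addr0; apply/negP; rewrite -ltNge.
  by rewrite !mulr_gt0 ?sqmod_gt0.
split; first exact: card_le_partition L_part.
exists L; split=> // [j|j l jl].
  apply: sub_finite_set (finite_geneigs v0_unit Y_unit).
  by case: L_part => <- _ _ U LU; exists j.
apply: lb_le_inf.
  have [U LU] := L0_neq0 (cast_ord (esym (prednK J_gt0)) j).
  have [V LV] := L0_neq0 (cast_ord (esym (prednK J_gt0)) l).
  by exists (chordalC U V), U, V.
by move=> _ [U [V [LU LV ->]]]; apply: L0_far LU LV; exact: castI.
Qed.
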